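(* Let $(A_j)_{j\in\mathbb N}$ be an increasing sequence of universally measurable subsets of $\mathbb R^n$ with union $A$, and let $f=\psi+U^\vartheta+U^\omega$ be an external field on $\overline A$ satisfying $\psi\in\Phi(\overline A)$, $\vartheta\in\mathcal E$, $\omega\in\mathfrak M$ bounded with $\inf_{x\in S(\omega),\,y\in A}|x-y|>0$, and $c_*(\{x\in A:\psi(x)<\infty\})>0$. Then $$w_f(A_j)\downarrow w_f(A)\quad\text{as }j\to\infty.$$ If moreover the minimizers $\lambda_{A,f}$ and $\lambda_{A_j,f}$ exist, then also $$\lambda_{A_j,f}\to\lambda_{A,f}\ \text{ strongly and vaguely in }\mathcal E^+\text{ as }j\to\infty,\qquad \lim_{j\to\infty}c_{A_j,f}=c_{A,f}.$$
   Context: Fix $n\ge 2$ and $0<\alpha<n$. $\mathfrak M$ is the space of real-valued (signed) Radon measures $\mu$ on $\mathbb R^n$, always assumed to satisfy $\int_{|y|>1}|y|^{\alpha-n}\,d|\mu|(y)<\infty$, with the vague topology (pointwise convergence on continuous functions of compact support); $\mathfrak M^+$ is the cone of positive ones; $\mu$ is bounded if $|\mu|(\mathbb R^n)<\infty$; $S(\mu)$ is the support. $U^\mu(x)=\int|x-y|^{\alpha-n}\,d\mu(y)$, $I(\mu,\nu)=\iint|x-y|^{\alpha-n}\,d\mu(x)\,d\nu(y)$, $I(\mu)=I(\mu,\mu)$. $\mathcal E$ is the pre-Hilbert space of all $\mu\in\mathfrak M$ of finite energy, with inner product $I(\mu,\nu)$ and norm $\|\mu\|=\sqrt{I(\mu)}$;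 the norm topology is called strong; $\mathcal E^+=\mathcal E\cap\mathfrak M^+$. For $Q\subset\mathbb R^n$: $\mathfrak M^+(Q)$ is the set of $\mu\in\mathfrak M^+$ concentrated on $Q$ (i.e. $\mathbb R^n\setminus Q$ is $\mu$-negligible); $\mathcal E^+(Q)=\mathcal E\cap\mathfrak M^+(Q)$; $\breve{\mathcal E}^+(Q)=\{\mu\in\mathcal E^+(Q):\mu(\mathbb R^n)=1\}$. Inner capacity: $c_*(Q)=1/\inf\{I(\mu):\mu\in\breve{\mathcal E}^+(Q)\}$ (with $\inf\varnothing=+\infty$, $1/(+\infty)=0$). For closed $F$, $\Phi(F)$ is the class of lower semicontinuous functions $g:F\to(-\infty,\infty]$ that are $\ge0$ unless $F$ is compact. For $\omega=0$ the distance from $S(\omega)=\varnothing$ to $A$ is $+\infty$. The field $f$ is well defined on $\overline A$ outside a set of zero outer capacity. For $Q\subset\overline A$, $\mathcal E^+_f(Q)$ is the set of $\mu\in\mathcal E^+(Q)$ for which $f$ is $\mu$-integrable, $\breve{\mathcal E}^+_f(Q)=\mathcal E^+_f(Q)\cap\breve{\mathcal E}^+(Q)$, $I_f(\mu)=I(\mu)+2\int f\,d\mu$, $w_f(Q)=\inf_{\mu\in\breve{\mathcal E}^+_f(Q)}I_f(\mu)$ ($+\infty$ if the class is empty). The minimizer $\lambda_{Q,f}$ is the measure in $\breve{\mathcal E}^+_f(Q)$ with $I_f(\lambda_{Q,f})=w_f(Q)$ (unique if it exists), and $c_{Q,f}:=\int(U^{\lambda_{Q,f}}+f)\,d\lambda_{Q,f}=w_f(Q)-\int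 f\,d\lambda_{Q,f}$. *)

(* Defs.v *)
From HB Require Import structures.
From mathcomp Require Import all_boot all_order all_algebra.
From mathcomp Require Import all_classical all_reals all_analysis.
From mathcomp Require Import measurable_realfun.

Set Implicit Arguments.
Unset Strict Implicit.
Unset Printing Implicit Defensive.

Import Order.TTheory GRing.Theory Num.Theory.
Import numFieldNormedType.Exports.

Local Open Scope classical_set_scope.
Local Open Scope ring_scope.

(* R^n is 'rV[R]_n with its library topology (induced by the sup norm, hence
   the Euclidean one), and [Rn R n] is the same type with its Borel sets. *)
Notation Rn R n := (g_sigma_algebraType (@open 'rV[R]_n)).

(* All measures are Borel measures; completions only enter through
   [mu.-negligible] and [completed_algebra_gen mu]. *)
Notation bmeasure R n := {measure set (Rn R n) -> \bar R%type}.

Definition enorm (R : realType) (n : nat) (x : 'rV[R]_n) : R :=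
  Num.sqrt (\sum_(i < n) x ord0 i ^+ 2).

(* A locally finite Borel measure on R^n is automatically regular. *)
Definition radon (R : realType) (n : nat) (mu : bmeasure R n) : Prop :=
  forall K : set 'rV[R]_n, compact K -> (mu K < +oo)%E.

Definition univ_measurable (R : realType) (n : nat) (Q : set 'rV[R]_n) : Prop :=
  forall mu : bmeasure R n, radon mu -> completed_algebra_gen mu Q.

Section riesz_potentials.
Context {R : realType} {n : nat}.
Variable alpha : R.
Implicit Types (mu nu : bmeasure R n) (x y : 'rV[R]_n) (Q F : set 'rV[R]_n).

(* The case distinction is needed: the library sets [0 `^ s = 0] for s < 0. *)
Definition riesz x y : \bar R :=
  if x == y then +oo%E else (enorm (x - y) `^ (alpha - n%:R))%:E.

Definition Mpos : set (bmeasure R n) := [set mu | radon mu /\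
  (\int[mu]_(y in [set y : Rn R n | (1 < enorm y)%R])
     (enorm y `^ (alpha - n%:R))%:E < +oo)%E].

(* A signed Radon measure is encoded by its Jordan decomposition, because it
   need not be defined (as an extended real) on unbounded Borel sets. *)
Record signed_radon := SignedRadon {
  pos_part : bmeasure R n ;
  neg_part : bmeasure R n ;
  pos_part_Mpos : Mpos pos_part ;
  neg_part_Mpos : Mpos neg_part ;
  mutually_singular : exists2 P : set (Rn R n), measurable P &
    pos_part (~` P) = 0%E /\ neg_part P = 0%E
}.
Implicit Types sigma tau : signed_radon.

Definition abs_radon sigma : bmeasure R n :=
  measure_add (pos_part sigma) (neg_part sigma).

Definition bounded_radon sigma : Prop :=
  (abs_radon sigma setT < +oo)%E.

Definition supp sigma : set 'rV[R]_n :=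
  [set x | forall U : set 'rV[R]_n, open U -> U x ->
     abs_radon sigma U != 0%E].

Definition potential mu x : \bar R := (\int[mu]_y riesz x y)%E.

Definition energy mu nu : \bar R := (\int[mu]_x potential nu x)%E.

(* With the library convention [+oo - +oo = -oo], this value is meaningful only
   where at least one of the two potentials is finite. *)
Definition spotential sigma x : \bar R :=
  (potential (pos_part sigma) x - potential (neg_part sigma) x)%E.

Definition senergy sigma tau : \bar R :=
  ((energy (pos_part sigma) (pos_part tau) +
    energy (neg_part sigma) (neg_part tau)) -
   (energy (pos_part sigma) (neg_part tau) +
    energy (neg_part sigma) (pos_part tau)))%E.

(* The kernel being positive, its double integral against sigma (x) sigma is
   well defined and finite iff it converges absolutely. *)
Definition finite_energy sigma : Prop :=
  (energy (abs_radon sigma) (abs_radon sigma) < +oo)%E.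

Definition snorm sigma : R := Num.sqrt (fine (senergy sigma sigma)).

Definition Epos Q : set (bmeasure R n) :=
  [set mu | [/\ Mpos mu, mu.-negligible (~` Q) & (energy mu mu < +oo)%E]].

Definition Epos1 Q : set (bmeasure R n) :=
  [set mu | Epos Q mu /\ mu setT = 1%E].

(* In the extended reals of the library 0^-1 = +oo and +oo^-1 = 0. *)
Definition inner_capacity Q : \bar R :=
  ((ereal_inf [set energy mu mu | mu in Epos1 Q])^-1)%E.

Definition Phi F (g : 'rV[R]_n -> \bar R) : Prop :=
  [/\ forall x, F x -> (-oo < g x)%E,
      lower_semicontinuous (g : subspace F -> \bar R)
    & ~ compact F -> forall x, F x -> (0 <= g x)%E].

Definition field (psi : 'rV[R]_n -> \bar R) (theta omega : signed_radon) x :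
    \bar R :=
  (psi x + spotential theta x + spotential omega x)%E.

(* Below, F is the closed set (the closure of A) on which the field f is given;
   the values of f outside of F are irrelevant. *)
Definition Epos1f F (f : 'rV[R]_n -> \bar R) Q : set (bmeasure R n) :=
  [set mu | Epos1 Q mu /\ mu.-integrable F f].

Definition fenergy F (f : 'rV[R]_n -> \bar R) mu : \bar R :=
  (energy mu mu + 2%:E * \int[mu]_(x in F) f x)%E.

Definition wf F (f : 'rV[R]_n -> \bar R) Q : \bar R :=
  ereal_inf [set fenergy F f mu | mu in Epos1f F f Q].

Definition is_minimizer F (f : 'rV[R]_n -> \bar R) Q (lam : bmeasure R n) :
    Prop :=
  Epos1f F f Q lam /\ fenergy F f lam = wf F f Q.

Definition cf F (f : 'rV[R]_n -> \bar R) (lam : bmeasure R n) : \bar R :=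
  (\int[lam]_(x in F) (potential lam x + f x))%E.

(* sigma = mu - nu, written without subtraction of infinite values *)
Definition is_difference mu nu sigma : Prop :=
  forall B : set (Rn R n), measurable B ->
    (pos_part sigma B + nu B = neg_part sigma B + mu B)%E.

(* The witnesses s j are unique on Borel sets: s j is the element mu_ j - mu of
   the pre-Hilbert space of signed measures of finite energy. *)
Definition strong_cvg (mu_ : nat -> bmeasure R n) mu : Prop :=
  exists s : nat -> signed_radon,
    (forall j, finite_energy (s j) /\ is_difference (mu_ j) mu (s j)) /\
    (fun j => snorm (s j)) @ \oo --> (0 : R).

End riesz_potentials.

Definition vague_cvg (R : realType) (n : nat) (mu_ : nat -> bmeasure R n)
    (mu : bmeasure R n) : Prop :=
  forall phi : 'rV[R]_n -> R, continuous phi ->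
    compact (closure [set x | phi x != 0]) ->
    (fun j => (\int[mu_ j]_x (phi x)%:E)%E) @ \oo -->
      (\int[mu]_x (phi x)%:E)%E.

(* Main.v *)
(** The convergence of [w_f(A_j)] follows by restricting a competitor for [A] to
    Borel subsets of the [A_j] exhausting it and normalizing. Convexity gives the
    parallelogram bound [|mu - lambda_A|^2 <= 2 (I_f(mu) - w_f(A))], hence the
    strong convergence.
    The Riesz kernel is a mixture [int exp (s v) exp (- e^v |x - y|^2) dv] of
    Gaussians, and a Gaussian in one coordinate is a mixture of rank one kernels
    [g(x - z) g(y - z)]; so all of them are positive definite, and only
    nonnegative integrals are ever exchanged. Conversely, small Riesz distance
    forces small Gaussian distance at every scale, so the integrals of Gaussians
    converge; uniform limits of combinations of Gaussians are stable under
    products, hence under absolute values and maxima, and exhaust [C_c]: strong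
    convergence of probability measures implies vague convergence. *)
Require Import Defs.
From HB Require Import structures.
From mathcomp Require Import all_boot all_order all_algebra.
From mathcomp Require Import all_classical all_reals all_analysis.
From mathcomp Require Import measurable_realfun ring lra.
Import Order.TTheory GRing.Theory Num.Theory.
Import numFieldNormedType.Exports.
Local Open Scope classical_set_scope.
Local Open Scope ring_scope.

(** Energies are extended reals and may be infinite, so positive definiteness is stated for pairs of
    finite positive measures, and terms are cancelled only after their energies are known to be
    finite. Gaussians are needed because a point mass has infinite Riesz energy: point evaluations,
    and with them test functions, cannot be paired directly with the Riesz norm. For a Gaussian
    kernel a point mass has energy one, so the integral of a Gaussian centred at [y] is an inner
    product with the Dirac measure at [y], and Cauchy-Schwarz controls it. A small average over the
    scales [v] does not by itself control a prescribed scale. What helps is that a Gaussian varies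
    slowly in [v], uniformly in the points, because X exp(-X) <= 1. Unit mass is used twice:
    constants integrate to themselves in that estimate, and a uniform approximation of a test
    function costs the same for all measures of the sequence. The constants [cf] need no separate
    limit for the field integral: since I_f = I + 2 int f and c = I + int f, one has c = (I + I_f) /
    2, so the energies and the minimal values suffice. *)

(** * Positive definite kernels: rank one kernels, mixtures, Gaussians *)

Section positive_definite_kernels.
Context {d} {T : measurableType d} {R : realType}.
Local Open Scope ereal_scope.
Implicit Types (mu nu : {finite_measure set T -> \bar R}) (k : T * T -> \bar R).

Definition kenergy k (mu nu : {measure set T -> \bar R}) : \bar R :=
  \int[mu]_x \int[nu]_y k (x, y).

(* Nonnegativity of the energy of [mu - nu], without subtraction. *)
Definition pos_def k : Prop := forall mu nu,
  2%:E * kenergy k mu nu <= kenergy k mu mu + kenergy k nu nu.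

Lemma kenergy_ge0 k (mu nu : {measure set T -> \bar R}) :
  (forall z, 0 <= k z) -> 0 <= kenergy k mu nu.
Proof. by move=> k0; apply: integral_ge0 => x _; exact: integral_ge0. Qed.

Lemma measurable_ksection k x :
  measurable_fun setT k -> measurable_fun setT (fun y => k (x, y)).
Proof. by move=> mk; apply: measurableT_comp => //; exact: measurable_pair1. Qed.

Lemma measurable_kpotential k (mk : measurable_fun setT k)
    (k0 : forall z, 0 <= k z) nu :
  measurable_fun setT (fun x => \int[nu]_y k (x, y)).
Proof. exact: (@measurable_fun_fubini_tonelli_F _ _ _ _ _ nu k). Qed.

Lemma kenergy_scale (c : R) k mu nu : (0 <= c)%R ->
  measurable_fun setT k -> (forall z, 0 <= k z) ->
  kenergy (fun p => c%:E * k p) mu nu = c%:E * kenergy k mu nu.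
Proof.
move=> c0 mk k0; rewrite /kenergy; under eq_integral => x _.
  rewrite ge0_integralZl_EFin//; last exact: measurable_ksection.
  over.
rewrite ge0_integralZl_EFin//; first by move=> x _; exact: integral_ge0.
exact: (measurable_kpotential k).
Qed.

Lemma kenergyC k mu nu : measurable_fun setT k -> (forall z, 0 <= k z) ->
  (forall x y, k (x, y) = k (y, x)) -> kenergy k mu nu = kenergy k nu mu.
Proof.
move=> mk k0 ksym; rewrite /kenergy (fubini_tonelli k)//.
by apply: eq_integral => x _; apply: eq_integral => y _.
Qed.

(** A named copy of the product measure that can carry the structure of a finite measure, so that it
    can be one factor in Tonelli's theorem, the mixing measure being the other. *)
Definition finite_prod (mu nu : {finite_measure set T -> \bar R}) :
    set (T * T)%type -> \bar R := (mu \x nu).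

HB.instance Definition _ mu nu := Measure.on (finite_prod mu nu).

Lemma fin_num_finite_prod mu nu : fin_num_fun (finite_prod mu nu).
Proof.
apply: lty_fin_num_fun.
suff : mu setT * nu setT < +oo by rewrite -product_measure1E// setXTT.
by rewrite lte_mul_pinfty ?fin_num_measure// ltey_eq fin_num_measure.
Qed.

HB.instance Definition _ mu nu :=
  Measure_isFinite.Build _ _ _ (finite_prod mu nu) (fin_num_finite_prod mu nu).

(** Tonelli twice: the double integral becomes one integral over the product measure, which is then
    exchanged with the mixing measure. *)
Lemma kenergy_mixture d' (Z : measurableType d')
    (m : {sigma_finite_measure set Z -> \bar R}) (K : (T * T) * Z -> \bar R)
    mu nu : measurable_fun setT K -> (forall w, 0 <= K w) ->
  kenergy (fun p => \int[m]_z K (p, z)) mu nu =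
  \int[m]_z kenergy (fun p => K (p, z)) mu nu.
Proof.
move=> mK K0; rewrite /kenergy.
have m1 : measurable_fun setT (fun p => \int[m]_z K (p, z)).
  exact: (@measurable_fun_fubini_tonelli_F _ _ _ _ _ m K).
transitivity (\int[mu \x nu]_p \int[m]_z K (p, z)).
  by rewrite fubini_tonelli1// => p; apply: integral_ge0.
rewrite (fubini_tonelli (m1 := finite_prod mu nu) K)//.
apply: eq_integral => z _; rewrite fubini_tonelli1//.
by apply: measurableT_comp => //; exact: measurable_pair2.
Qed.

Lemma measurable_kenergy_mixture d' (Z : measurableType d')
    (K : (T * T) * Z -> \bar R) mu nu :
  measurable_fun setT K -> (forall w, 0 <= K w) ->
  measurable_fun setT (fun z => kenergy (fun p => K (p, z)) mu nu).
Proof.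
move=> mK K0.
rewrite (_ : (fun z => _) = (fun z => \int[mu \x nu]_p K (p, z))).
  exact: (@measurable_fun_fubini_tonelli_G _ _ _ _ _ (finite_prod mu nu) K).
apply/funext => z; rewrite fubini_tonelli1//.
by apply: measurableT_comp => //; exact: measurable_pair2.
Qed.

(** Both sides of the inequality defining [pos_def] are sums of nonnegative terms, so it can be
    integrated in the mixing variable without any finiteness condition. *)
Lemma pos_def_mixture d' (Z : measurableType d')
    (m : {sigma_finite_measure set Z -> \bar R}) (K : (T * T) * Z -> \bar R) :
  measurable_fun setT K -> (forall w, 0 <= K w) ->
  (forall z, pos_def (fun p => K (p, z))) ->
  pos_def (fun p => \int[m]_z K (p, z)).
Proof.
move=> mK K0 pK mu nu; rewrite !kenergy_mixture//.
have mE (a b : {finite_measure set T -> \bar R}) :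
    measurable_fun setT (fun z => kenergy (fun p => K (p, z)) a b).
  exact: measurable_kenergy_mixture.
have E0 (a b : {measure set T -> \bar R}) z :
    0 <= kenergy (fun p => K (p, z)) a b by exact: kenergy_ge0.
rewrite -ge0_integralZl_EFin// -ge0_integralD//.
apply: ge0_le_integral => //.
- by move=> z _; rewrite mule_ge0.
- by apply: emeasurable_funM => //; exact: measurable_cst.
- by apply: emeasurable_funD.
- by move=> z _; exact: pK.
Qed.

Lemma pos_def_scale k (c : R) : (0 <= c)%R -> measurable_fun setT k ->
  (forall z, 0 <= k z) -> pos_def k -> pos_def (fun p => c%:E * k p).
Proof.
move=> c0 mk k0 pk mu nu.
by rewrite !kenergy_scale// muleCA -ge0_muleDr ?kenergy_ge0// lee_wpmul2l.
Qed.

(** The energy factors as the product of the integrals a and b of [h], and the claim becomes 2ab <=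
    a^2 + b^2. As [h] need not be integrable, the infinite cases are treated apart. *)
Lemma pos_def_rank1 (h : T -> R) : measurable_fun setT h ->
  (forall x, 0 <= h x)%R -> pos_def (fun p => (h p.1 * h p.2)%:E).
Proof.
move=> mh h0 mu nu.
have mh' : measurable_fun setT (EFin \o h) by exact/measurable_EFinP.
have E (a b : {finite_measure set T -> \bar R}) : kenergy (fun p => (h p.1 * h p.2)%:E) a b =
    (\int[a]_x (h x)%:E) * (\int[b]_x (h x)%:E).
  rewrite /kenergy/=; under eq_integral => x _.
    under eq_integral => y _ do rewrite EFinM.
    rewrite ge0_integralZl_EFin//; last by move=> y _; rewrite lee_fin.
    over.
  rewrite -ge0_integralZr//; last 2 first.
    by move=> x _; rewrite lee_fin.
    by apply: integral_ge0 => x _; rewrite lee_fin.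
rewrite !E.
have : 0 <= \int[nu]_x (h x)%:E by apply: integral_ge0 => x _; rewrite lee_fin.
have : 0 <= \int[mu]_x (h x)%:E by apply: integral_ge0 => x _; rewrite lee_fin.
case: (\int[mu]_x (h x)%:E) => [a| |]//; case: (\int[nu]_x (h x)%:E) => [b| |]//.
- move=> _ _; rewrite -!EFinM -EFinD lee_fin.
  have := sqr_ge0 (a - b)%R; nra.
- by move=> a0 _; rewrite mulyy addey ?leey// -EFinM ltNyr.
- by move=> _ a0; rewrite mulyy addye ?leey// -EFinM ltNyr.
- by rewrite mulyy addye ?leey.
Qed.

Lemma measurable_expR_sqr d' (X : measurableType d') (c : R) (u v : X -> R) :
  measurable_fun setT u -> measurable_fun setT v ->
  measurable_fun setT (fun x => expR (c * (u x - v x) ^+ 2)).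
Proof.
move=> mu_ mv_; apply: (measurableT_comp (@measurable_expR R)).
by apply: measurable_funM => //; apply: measurable_funX; exact: measurable_funB.
Qed.

(** With m = (a + b) / 2, completing the square gives (a - z)^2 + (b - z)^2 = 2 (z - m)^2 + (a -
    b)^2 / 2. At rate 2t the integrand is thus exp(-t (a - b)^2) times exp(-4t (z - m)^2), an
    unnormalized normal density of mean m and variance 1 / (8t); [C] is its normalizing constant. *)
Lemma expR_sqr_mixture (t : R) : (0 < t)%R -> exists2 C : R, (0 <= C)%R &
  forall a b : R, (expR (- t * (a - b) ^+ 2))%:E =
   C%:E * \int[lebesgue_measure]_z
     (expR (- (2 * t) * (a - z) ^+ 2) * expR (- (2 * t) * (b - z) ^+ 2))%:E.
Proof.
move=> t0.
pose s := Num.sqrt ((8 * t)^-1).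
have s2 : (s ^+ 2 = (8 * t)^-1)%R by rewrite sqr_sqrtr// invr_ge0; lra.
have sn0 : s != 0%R by rewrite sqrtr_eq0 -ltNge invr_gt0; lra.
exists (normal_peak s); first exact: normal_peak_ge0.
move=> a b.
rewrite -ge0_integralZl_EFin ?normal_peak_ge0//; last first.
  apply/measurable_EFinP/measurable_funM; exact: measurable_expR_sqr.
transitivity ((expR (- t * (a - b) ^+ 2))%:E *
    \int[lebesgue_measure]_z (normal_pdf ((a + b) / 2)%R s z)%:E).
  by rewrite integral_normal_pdf mule1.
rewrite -ge0_integralZl_EFin ?expR_ge0//; last 2 first.
  by move=> z _; rewrite lee_fin normal_pdf_ge0.
  by apply/measurable_EFinP; exact: measurable_normal_pdf.
apply: eq_integral => z _; rewrite -!EFinM; congr EFin.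
rewrite normal_pdfE// mulrCA -!expRD; congr (_ * expR _)%R.
have -> : (s ^+ 2 *+ 2 = (4 * t)^-1)%R.
  by rewrite s2; field; rewrite gt_eqF//; lra.
by rewrite invrK; field.
Qed.

(** Induction on the coordinates. The weight [h] is there for the induction: writing one coordinate
    as a mixture of rank one kernels multiplies [h] by a Gaussian in that coordinate, and the
    remaining coordinates are handled with the new weight. *)
Lemma pos_def_gauss (I : Type) (s : seq I) (u : I -> T -> R) (t : R) :
  (0 < t)%R -> (forall i, measurable_fun setT (u i)) -> forall h : T -> R,
  measurable_fun setT h -> (forall x, 0 <= h x)%R ->
  pos_def (fun p => (expR (- t * \sum_(i <- s) (u i p.1 - u i p.2) ^+ 2)
     * (h p.1 * h p.2))%:E).
Proof.
move=> t0 mu_; have [C C0 HC] := expR_sqr_mixture t t0.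
elim: s => [|i s IH] h mh h0.
  rewrite (_ : (fun p => _) = (fun p => (h p.1 * h p.2)%:E)).
    exact: pos_def_rank1.
  by apply/funext => p; rewrite big_nil mulr0 expR0 mul1r.
pose g z x := (expR (- (2 * t) * (u i x - z) ^+ 2) * h x)%R.
pose K (w : (T * T) * measurableTypeR R) : \bar R :=
  (expR (- t * \sum_(i <- s) (u i w.1.1 - u i w.1.2) ^+ 2)
     * (g w.2 w.1.1 * g w.2 w.1.2))%:E.
have K0 w : 0 <= K w by rewrite lee_fin !mulr_ge0 ?expR_ge0.
have mu1 j : measurable_fun setT (fun w : (T * T) * measurableTypeR R => u j w.1.1).
  apply: measurableT_comp => //; exact: (measurableT_comp measurable_fst).
have mu2 j : measurable_fun setT (fun w : (T * T) * measurableTypeR R => u j w.1.2).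
  apply: measurableT_comp => //; exact: (measurableT_comp measurable_snd).
have mh1 : measurable_fun setT (fun w : (T * T) * measurableTypeR R => h w.1.1).
  apply: measurableT_comp => //; exact: (measurableT_comp measurable_fst).
have mh2 : measurable_fun setT (fun w : (T * T) * measurableTypeR R => h w.1.2).
  apply: measurableT_comp => //; exact: (measurableT_comp measurable_snd).
have mK : measurable_fun setT K.
  apply/measurable_EFinP/measurable_funM.
    apply: measurableT_comp => //; apply: measurable_funM => //.
    apply: measurable_sum => j; apply: measurable_funX.
    exact: measurable_funB.
  apply: measurable_funM; apply: measurable_funM => //;
    apply: measurable_expR_sqr => //; exact: measurable_snd.
rewrite (_ : (fun p => _) =
    (fun p => C%:E * \int[lebesgue_measure]_z K (p, z))).
  apply: pos_def_scale => //.
  - exact: (@measurable_fun_fubini_tonelli_F _ _ _ _ _ lebesgue_measure K).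
  - by move=> p; exact: integral_ge0.
  - apply: pos_def_mixture => // z; apply: (IH (g z)) => [|x].
      by apply: measurable_funM => //; exact: measurable_expR_sqr.
    by rewrite mulr_ge0 ?expR_ge0.
apply/funext => p.
rewrite big_cons mulrDr expRD -mulrA EFinM HC -muleA; congr (_ * _).
rewrite muleC -ge0_integralZl_EFin; last 4 first.
- exact: measurableT.
- by move=> z _; rewrite lee_fin mulr_ge0 ?expR_ge0.
- apply/measurable_EFinP/measurable_funM; exact: measurable_expR_sqr.
- by rewrite !mulr_ge0 ?expR_ge0.
apply: eq_integral => z _; rewrite -!EFinM /K/= /g; congr EFin; ring.
Qed.

End positive_definite_kernels.

(** * Invariance of Lebesgue measure under translation and reflection *)

Section lebesgue_invariance.
Context {R : realType}.
Local Open Scope ereal_scope.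
Local Notation mu := (@lebesgue_measure R).

Lemma lebesgue_measure_translate (a : R) (A : set R) : measurable A ->
  pushforward mu ((fun x => x + a)%R : _ -> measurableTypeR R) A = mu A.
Proof.
move=> mA; apply/esym.
have mphi : measurable_fun setT ((fun x => x + a)%R : measurableTypeR R -> measurableTypeR R).
  by apply: measurable_funD.
apply: (@lebesgue_measure_unique R (@pushforward _ _ _ _ _ mu
  ((fun x => x + a)%R : measurableTypeR R -> measurableTypeR R))) => //.
move=> _ [[b c]] _ <-.
have E : (fun x => x + a)%R @^-1` `]b, c]%classic = `](b - a)%R, (c - a)%R]%classic.
  by apply/seteqP; split => x /=; rewrite !in_itv/= ltrBlDr lerBrDr.
transitivity (mu `](b - a)%R, (c - a)%R]%classic); last by rewrite -E.
rewrite !lebesgue_measure_itv/= !lte_fin ltrD2r -!EFinB.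
by congr (if _ then _ else _); congr EFin; ring.
Qed.

Lemma ge0_integral_translate (a : R) (f : R -> \bar R) :
  measurable_fun setT f -> (forall x, 0 <= f x) ->
  \int[mu]_x f (x + a)%R = \int[mu]_x f x.
Proof.
move=> mf f0.
have mphi : measurable_fun setT ((fun x => x + a)%R : measurableTypeR R -> measurableTypeR R).
  by apply: measurable_funD.
have := @ge0_integral_pushforward _ _ _ _ R _ mphi mu setT f measurableT mf.
rewrite preimage_setT => <-; last by move=> y _; exact: f0.
by apply: eq_measure_integral => /= A mA _; exact: lebesgue_measure_translate.
Qed.

Lemma ge0_integral_opp (f : R -> \bar R) :
  measurable_fun setT f -> (forall x, 0 <= f x) ->
  \int[mu]_x f (- x)%R = \int[mu]_x f x.
Proof.
move=> mf f0.
have mphi : measurable_fun setT (-%R : measurableTypeR R -> measurableTypeR R).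
  exact: oppr_measurable.
have := @ge0_integral_pushforward _ _ _ _ R _ mphi mu setT f measurableT mf.
rewrite preimage_setT => <-; last by move=> y _; exact: f0.
by apply: eq_measure_integral => /= A mA _; exact: lebesgue_measureN.
Qed.

End lebesgue_invariance.

(** * The Gamma integral on a logarithmic scale *)

Section laplace_representation.
Context {R : realType}.
Local Open Scope ereal_scope.
Local Notation mu := (@lebesgue_measure R).

(* The integrand of the Gamma integral of [u `^ (- s)] after substituting
   [expR v] for the integration variable. *)
Definition laplace (s : R) (u v : R) : R := (expR (s * v) * expR (- expR v * u))%R.

Lemma laplace_ge0 (s u v : R) : (0 <= laplace s u v)%R.
Proof. by rewrite mulr_ge0 ?expR_ge0. Qed.

Lemma measurable_laplace s u : measurable_fun setT (laplace s u).
Proof.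
apply: measurable_funM; apply: (measurableT_comp (@measurable_expR R)).
  exact: measurable_funM.
apply: measurable_funM => //; apply: measurableT_comp => //.
Qed.

Lemma integral_laplace_lty (s : R) : (0 < s)%R -> \int[mu]_v (laplace s 1 v)%:E < +oo.
Proof.
(* The integrand is dominated by a two-sided exponential density. For [v >= 0] the tangent of [expR]
   at [ln (2 * s)] gives expR v >= 2s (1 + v - ln (2s)), hence s v - expR v <= - s v + ln c; for
   [v < 0] the integrand is at most [expR (s * v)]. Dividing by [s] in [C] undoes the factor of the
   exponential density. *)
move=> s0; pose c := expR (2 * s * (ln (2 * s) - 1)).
pose C := ((c + 1) / s)%R.
have C0 : (0 <= C)%R by rewrite divr_ge0 ?addr_ge0 ?expR_ge0 ?ltW.
pose p := exponential_pdf s.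
have mp : measurable_fun setT (EFin \o p).
  by apply/measurable_EFinP; exact: measurable_exponential_pdf.
have mpN : measurable_fun setT (fun v : R => (p (- v))%:E).
  apply/measurable_EFinP; apply: (measurableT_comp (measurable_exponential_pdf _)).
  exact: oppr_measurable.
have p0 v : (0 <= p v)%R by exact/exponential_pdf_ge0/ltW.
have pE v : (0 <= v)%R -> (C * p v = (c + 1) * expR (- s * v))%R.
  by move=> v0; rewrite /p exponential_pdfE//= /C; field; rewrite gt_eqF.
have bound v : (laplace s 1 v <= C * (p v + p (- v)))%R.
  have [v0|v0] := leP 0%R v.
    apply: (@le_trans _ _ (C * p v)%R); last by rewrite ler_wpM2l// lerDl.
    rewrite pE//.
    apply: (@le_trans _ _ (c * expR (- s * v))%R); last first.
      by rewrite ler_wpM2r ?expR_ge0// lerDl.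
    rewrite /laplace -!expRD ler_expR mulr1.
    have : (2 * s * (1 + (v - ln (2 * s))) <= expR v)%R.
      rewrite -[leRHS](@mulfVK _ (2 * s)%R) ?gt_eqF//; last lra.
      rewrite mulrC ler_wpM2r//; first lra.
      rewrite -[X in (_ <= _ / X)%R](@lnK _ (2 * s)%R) ?posrE; last lra.
      by rewrite -expRB; exact: expR_ge1Dx.
    rewrite !mulrDr; lra.
  apply: (@le_trans _ _ (C * p (- v))%R); last by rewrite ler_wpM2l// lerDr.
  rewrite pE; last lra.
  rewrite mulrNN mulrDl mul1r.
  apply: (@le_trans _ _ (expR (s * v))); last first.
    by rewrite lerDr mulr_ge0 ?expR_ge0.
  by rewrite /laplace ler_piMr ?expR_ge0// mulr1 -expR0 ler_expR oppr_le0 expR_ge0.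
apply: (@le_lt_trans _ _ (\int[mu]_v (C%:E * ((p v)%:E + (p (- v))%:E)))).
  apply: ge0_le_integral => //.
  - by move=> v _; rewrite lee_fin laplace_ge0.
  - by apply/measurable_EFinP; exact: measurable_laplace.
  - by apply: emeasurable_funM => //; exact: emeasurable_funD.
  by move=> v _; rewrite -EFinD -EFinM lee_fin.
rewrite ge0_integralZl_EFin//; last 2 first.
  by move=> v _; rewrite adde_ge0 ?lee_fin.
  exact: emeasurable_funD.
rewrite ge0_integralD//; last 2 first.
  by move=> v _; rewrite lee_fin.
  by move=> v _; rewrite lee_fin.
rewrite (ge0_integral_opp (fun v => (p v)%:E))// integral_exponential_pdf//.
by rewrite ltry.
Qed.

Lemma integral_laplace_gt0 (s : R) : (0 < s)%R -> 0 < \int[mu]_v (laplace s 1 v)%:E.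
Proof.
move=> s0; apply: (@lt_le_trans _ _ (\int[mu]_(v in `[0%R, 1%R]) (laplace s 1 v)%:E)); last first.
  apply: ge0_subset_integral => //.
    by apply/measurable_EFinP; exact: measurable_laplace.
  by move=> v _; rewrite lee_fin laplace_ge0.
apply: (@lt_le_trans _ _ (\int[mu]_(v in `[0%R, 1%R]) (expR (- expR 1))%:E)).
  rewrite integral_cst//= lebesgue_measure_itv/= lte_fin ltr01 oppr0 adde0 mule1.
  by rewrite lte_fin expR_gt0.
apply: ge0_le_integral => //.
  by apply: measurable_funTS; apply/measurable_EFinP; exact: measurable_laplace.
move=> v /=; rewrite in_itv/= => /andP[v0 v1]; rewrite lee_fin.
rewrite /laplace -expRD ler_expR mulr1.
have : (expR v <= expR 1)%R by rewrite ler_expR.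
have : (0 <= s * v)%R by rewrite mulr_ge0// ltW.
lra.
Qed.

(** This is the diagonal of the Riesz kernel: at distance zero the integrand is [expR (s * v)], at
    least 1 on the positive half-line. *)
Lemma integral_laplace0 (s : R) : (0 < s)%R -> \int[mu]_v (laplace s 0 v)%:E = +oo.
Proof.
move=> s0; apply/eqP; rewrite eq_le leey/=.
apply: (@le_trans _ _ (\int[mu]_(v in `[0%R, +oo[) (laplace s 0 v)%:E)); last first.
  apply: ge0_subset_integral => //.
    by apply/measurable_EFinP; exact: measurable_laplace.
  by move=> v _; rewrite lee_fin laplace_ge0.
apply: (@le_trans _ _ (\int[mu]_(v in `[0%R, +oo[) 1%:E)).
  by rewrite integral_cst//= lebesgue_measure_itv/= ltry mul1e.
apply: ge0_le_integral => //.
  by apply: measurable_funTS; apply/measurable_EFinP; exact: measurable_laplace.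
move=> v /=; rewrite in_itv/= andbT => v0; rewrite lee_fin.
by rewrite /laplace mulr0 expR0 mulr1 -expR0 ler_expR mulr_ge0// ltW.
Qed.

(** Scaling the distance by [d] is a translation on the logarithmic scale: shifting [v] by
    [2 * ln d] turns [expR v] into d^2 [expR v] and produces the factor d^(2s). *)
Lemma integral_laplace (s : R) (d : R) : (0 < d)%R ->
  \int[mu]_v (laplace s (d ^+ 2) v)%:E =
  (d `^ (- (2 * s)))%:E * \int[mu]_v (laplace s 1 v)%:E.
Proof.
move=> d0.
have m1 := measurable_laplace s 1.
rewrite -(ge0_integral_translate (2 * ln d)%R (fun v => (laplace s 1 v)%:E)); last 2 first.
  exact/measurable_EFinP.
  by move=> v; rewrite lee_fin laplace_ge0.
rewrite -ge0_integralZl_EFin ?powR_ge0//; last 2 first.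
  by move=> v _; rewrite lee_fin laplace_ge0.
  apply: (measurableT_comp (f := fun v => (laplace s 1 v)%:E)); first exact/measurable_EFinP.
  exact: measurable_funD.
apply: eq_integral => v _; rewrite -EFinM; congr EFin.
rewrite /laplace /powR gt_eqF// mulr1 (expRD v) expRM_natl lnK//.
by rewrite -!expRD; congr expR; ring.
Qed.

End laplace_representation.

(** * Nonnegative combinations of measures *)

Section measure_combination.
Context {d} {T : measurableType d} {R : realType}.
Local Open Scope ereal_scope.

Definition mcomb (a b : {nonneg R}) (mu nu : {measure set T -> \bar R}) :
  set T -> \bar R := measure_add (mscale a mu) (mscale b nu).

HB.instance Definition _ a b mu nu := Measure.on (mcomb a b mu nu).

Lemma mcombE a b mu nu A :
  mcomb a b mu nu A = a%:num%:E * mu A + b%:num%:E * nu A.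
Proof. exact: measure_addE. Qed.

Section finite_combination.
Variables (a b : {nonneg R}) (mu nu : {finite_measure set T -> \bar R}).

Lemma fin_num_mcomb : fin_num_fun (mcomb a b mu nu).
Proof.
by move=> A mA; rewrite mcombE fin_numD !fin_numM// fin_num_measure.
Qed.

HB.instance Definition _ :=
  Measure_isFinite.Build _ _ _ (mcomb a b mu nu) fin_num_mcomb.

Definition fcomb : {finite_measure set T -> \bar R} := mcomb a b mu nu.

End finite_combination.

Lemma ge0_integral_mcomb a b (mu nu : {measure set T -> \bar R}) (D : set T)
    (f : T -> \bar R) : measurable D -> measurable_fun D f ->
  (forall x, D x -> 0 <= f x) ->
  \int[mcomb a b mu nu]_(x in D) f x =
  a%:num%:E * \int[mu]_(x in D) f x + b%:num%:E * \int[nu]_(x in D) f x.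
Proof.
by move=> mD mf f0; rewrite ge0_integral_measure_add// !ge0_integral_mscale.
Qed.

Lemma integrable_mcomb a b (mu nu : {measure set T -> \bar R}) (D : set T)
    (f : T -> \bar R) : measurable D ->
  mu.-integrable D f -> nu.-integrable D f -> (mcomb a b mu nu).-integrable D f.
Proof.
move=> mD /integrableP[mf imu] /integrableP[_ inu]; apply/integrableP; split=> //.
rewrite ge0_integral_mcomb//; last exact: measurableT_comp.
by rewrite lte_add_pinfty// lte_mul_pinfty.
Qed.

Lemma integral_mcomb a b (mu nu : {measure set T -> \bar R}) (D : set T)
    (f : T -> \bar R) : measurable D ->
  mu.-integrable D f -> nu.-integrable D f ->
  \int[mcomb a b mu nu]_(x in D) f x =
  a%:num%:E * \int[mu]_(x in D) f x + b%:num%:E * \int[nu]_(x in D) f x.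
Proof.
move=> mD imu inu; have mf := measurable_int _ imu.
rewrite !(integralE _ D f).
rewrite !ge0_integral_mcomb//; last 2 first.
- exact: measurable_funeneg.
- exact: measurable_funepos.
have := integral_fune_fin_num mD imu.
have := integral_fune_fin_num mD inu.
have := integral_fune_fin_num mD (integrable_funepos mD imu).
have := integral_fune_fin_num mD (integrable_funepos mD inu).
have := integral_fune_fin_num mD (integrable_funeneg mD imu).
have := integral_fune_fin_num mD (integrable_funeneg mD inu).
move: (\int[nu]_(x in D) f^\- x) (\int[mu]_(x in D) f^\- x).
move: (\int[nu]_(x in D) f^\+ x) (\int[mu]_(x in D) f^\+ x).
move=> [x| |] [y| |] [z| |] [t| |]//= _ _ _ _ _ _.
by congr EFin; ring.
Qed.

End measure_combination.

(** * Energy distance and Cauchy-Schwarz for a positive definite kernel *)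

Section kernel_energy_norm.
Context {d} {T : measurableType d} {R : realType}.
Local Open Scope ereal_scope.
Implicit Types (mu nu tau : {finite_measure set T -> \bar R}).
Variable k : T * T -> \bar R.
Hypotheses (mk : measurable_fun setT k) (k0 : forall z, 0 <= k z)
  (ksym : forall x y, k (x, y) = k (y, x)) (pk : pos_def k).

Lemma kenergy_fcombl a b mu1 mu2 nu :
  kenergy k (fcomb a b mu1 mu2) nu =
  a%:num%:E * kenergy k mu1 nu + b%:num%:E * kenergy k mu2 nu.
Proof.
rewrite /kenergy [LHS]ge0_integral_mcomb//.
  exact: measurable_kpotential.
by move=> x _; exact: integral_ge0.
Qed.

Lemma kenergy_fcombr a b mu nu1 nu2 :
  kenergy k mu (fcomb a b nu1 nu2) =
  a%:num%:E * kenergy k mu nu1 + b%:num%:E * kenergy k mu nu2.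
Proof.
rewrite (kenergyC _ mu _ mk k0 ksym) (kenergy_fcombl a b nu1 nu2 mu).
by rewrite (kenergyC _ nu1 mu mk k0 ksym) (kenergyC _ nu2 mu mk k0 ksym).
Qed.

Lemma kenergy_fin_num (mu nu : {measure set T -> \bar R}) :
  kenergy k mu nu < +oo -> kenergy k mu nu \is a fin_num.
Proof. by rewrite ge0_fin_numE// kenergy_ge0. Qed.

Lemma kenergy_cross_lty mu nu :
  kenergy k mu mu < +oo -> kenergy k nu nu < +oo -> kenergy k mu nu < +oo.
Proof.
move=> m n; have := pk mu nu.
case: (kenergy k mu nu) (kenergy_ge0 _ mu nu k0) => [r| |]// _.
  by rewrite ltry.
by rewrite gt0_muley ?lte_fin// leye_eq => /eqP E; move: (lte_add_pinfty m n); rewrite E.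
Qed.

Definition real_energy (mu nu : {measure set T -> \bar R}) : R := fine (kenergy k mu nu).

Lemma kenergyE (mu nu : {measure set T -> \bar R}) :
  kenergy k mu nu < +oo -> kenergy k mu nu = (real_energy mu nu)%:E.
Proof. by move=> h; rewrite fineK// kenergy_fin_num. Qed.

Lemma real_energyC (mu nu : {finite_measure set T -> \bar R}) : real_energy mu nu = real_energy nu mu.
Proof. by rewrite /real_energy (kenergyC _ _ _ mk k0 ksym). Qed.

(** The squared energy norm of [mu - nu], expanded so that only positive measures occur. It has this
    meaning when the three energies are finite. *)
Definition energy_dist2 (mu nu : {measure set T -> \bar R}) : R :=
  (real_energy mu mu + real_energy nu nu - 2 * real_energy mu nu)%R.

Lemma energy_dist2_ge0 mu nu :
  kenergy k mu mu < +oo -> kenergy k nu nu < +oo -> (0 <= energy_dist2 mu nu)%R.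
Proof.
move=> m n; have := pk mu nu; have mn := kenergy_cross_lty _ _ m n.
rewrite -(fineK (kenergy_fin_num _ _ m)) -(fineK (kenergy_fin_num _ _ n)).
rewrite -(fineK (kenergy_fin_num _ _ mn)) -EFinM -EFinD lee_fin.
rewrite /energy_dist2 /real_energy; lra.
Qed.

(** Cauchy-Schwarz for [mu - nu] against [tau] with a free parameter instead of square roots: it
    expresses that both [mu - nu + c tau] and [mu - nu - c tau] have nonnegative energy. The two
    signs come from adding [c tau] to [mu] or to [nu]. *)
Lemma energy_dist2_bound mu nu tau (c : R) : (0 <= c)%R ->
  kenergy k mu mu < +oo -> kenergy k nu nu < +oo -> kenergy k tau tau < +oo ->
  (2 * c * `|real_energy mu tau - real_energy nu tau| <=
   energy_dist2 mu nu + c ^+ 2 * real_energy tau tau)%R.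
Proof.
move=> c0 m n t.
have mn := kenergy_cross_lty _ _ m n; have mt := kenergy_cross_lty _ _ m t.
have nt := kenergy_cross_lty _ _ n t.
have nm := kenergy_cross_lty _ _ n m; have tm := kenergy_cross_lty _ _ t m.
have tn := kenergy_cross_lty _ _ t n.
have := pk (fcomb (NngNum (@ler01 R)) (NngNum c0) mu tau) nu.
have := pk mu (fcomb (NngNum (@ler01 R)) (NngNum c0) nu tau).
rewrite !(kenergy_fcombl, kenergy_fcombr)/= !mul1e.
rewrite (kenergyC _ tau mu mk k0 ksym) (kenergyC _ tau nu mk k0 ksym).
rewrite -(fineK (kenergy_fin_num _ _ m)) -(fineK (kenergy_fin_num _ _ n)).
rewrite -(fineK (kenergy_fin_num _ _ mn)) -(fineK (kenergy_fin_num _ _ mt)).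
rewrite -(fineK (kenergy_fin_num _ _ nt)) -(fineK (kenergy_fin_num _ _ t)).
rewrite -!EFinM -!EFinD !lee_fin.
rewrite /energy_dist2 /real_energy.
move: (fine _) (fine _) (fine _) (fine _) (fine _) (fine _); clear => x1 x2 x3 x4 x5 x6.
by have [_|_] := ler0P; lra.
Qed.

End kernel_energy_norm.

Section kernel_energy_comparison.
Context {d} {T : measurableType d} {R : realType}.
Local Open Scope ereal_scope.
Implicit Types (mu nu : {finite_measure set T -> \bar R}).

Lemma le_kenergy (k1 k2 : T * T -> \bar R) mu nu :
  measurable_fun setT k1 -> measurable_fun setT k2 ->
  (forall z, 0 <= k1 z) -> (forall z, k1 z <= k2 z) ->
  kenergy k1 mu nu <= kenergy k2 mu nu.
Proof.
move=> m1 m2 k10 k12.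
have k20 z : 0 <= k2 z by exact: le_trans (k12 z).
apply: ge0_le_integral => //.
- by move=> x _; exact: integral_ge0.
- exact: (measurable_kpotential k1).
- exact: (measurable_kpotential k2).
- by move=> x _; apply: ge0_le_integral => //; exact: measurable_ksection.
Qed.

Lemma kenergyD (k1 k2 : T * T -> \bar R) mu nu :
  measurable_fun setT k1 -> measurable_fun setT k2 ->
  (forall z, 0 <= k1 z) -> (forall z, 0 <= k2 z) ->
  kenergy (fun z => k1 z + k2 z) mu nu = kenergy k1 mu nu + kenergy k2 mu nu.
Proof.
move=> m1 m2 k10 k20; rewrite /kenergy -ge0_integralD//.
- apply: eq_integral => x _; rewrite ge0_integralD//; exact: measurable_ksection.
- by move=> x _; exact: integral_ge0.
- exact: (measurable_kpotential k1).
- by move=> x _; exact: integral_ge0.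
- exact: (measurable_kpotential k2).
Qed.

Lemma kenergy_cst (c : R) (mu nu : {measure set T -> \bar R}) : mu setT = 1 -> nu setT = 1 ->
  kenergy (cst c%:E) mu nu = c%:E.
Proof.
move=> m1 n1; rewrite /kenergy; under eq_integral => x _.
  rewrite integral_cst// [X in _ * X]n1 mule1.
  over.
by rewrite integral_cst// [X in _ * X]m1 mule1.
Qed.

End kernel_energy_comparison.

(** * Gaussian and Riesz kernels on R^n *)

Section euclidean_kernels.
Context {R : realType} {n : nat}.
Implicit Types (x y : Rn R n).

Lemma continuous_measurable_Rn (f : 'rV[R]_n -> R) :
  continuous f -> measurable_fun [set: Rn R n] (f : Rn R n -> R).
Proof.
move=> cf; apply: (measurability _ (RGenOpens.measurableE R)).
move=> _ [_ [a [b ->] <-]]; rewrite setTI; apply: sub_sigma_algebra.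
by move/continuousP : cf; apply; exact: interval_open.
Qed.

Definition sqdist x y : R := \sum_(i < n) (x ord0 i - y ord0 i) ^+ 2.

Lemma sqdist_ge0 x y : 0 <= sqdist x y.
Proof. by apply: sumr_ge0 => i _; exact: sqr_ge0. Qed.

Lemma sqr_enormB x y : enorm (x - y) ^+ 2 = sqdist x y.
Proof.
rewrite /enorm sqr_sqrtr; last by apply: sumr_ge0 => i _; exact: sqr_ge0.
by apply: eq_bigr => i _; rewrite !mxE.
Qed.

Lemma sqdist_sym x y : sqdist x y = sqdist y x.
Proof. by apply: eq_bigr => i _; rewrite -sqrrN opprB. Qed.

Lemma sqdist_eq0 x y : (sqdist x y == 0) = (x == y).
Proof.
rewrite psumr_eq0; last by move=> i _; exact: sqr_ge0.
apply/allP/eqP => [H|-> i _]; last by rewrite subrr expr0n/= eqxx.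
apply/rowP => i; apply/eqP; rewrite -subr_eq0 -sqrf_eq0.
exact: (H i (mem_index_enum i)).
Qed.

Lemma measurable_coord i : measurable_fun [set: Rn R n] (fun x : Rn R n => x ord0 i : R).
Proof. by apply: continuous_measurable_Rn => x; exact: coord_continuous. Qed.

Lemma measurable_sqdist :
  measurable_fun setT (fun p : Rn R n * Rn R n => sqdist p.1 p.2).
Proof.
apply: measurable_sum => i; apply: measurable_funX.
by apply: measurable_funB;
  apply: (measurableT_comp (measurable_coord i));
  [exact: measurable_fst|exact: measurable_snd].
Qed.

Local Open Scope ereal_scope.

Definition gaussk (t : R) (p : Rn R n * Rn R n) : \bar R :=
  (expR (- t * sqdist p.1 p.2))%:E.

Lemma measurable_gaussk t : measurable_fun setT (gaussk t).
Proof.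
apply/measurable_EFinP; apply: (measurableT_comp (@measurable_expR R)).
by apply: measurable_funM => //; exact: measurable_sqdist.
Qed.

Lemma gaussk_ge0 t p : 0 <= gaussk t p.
Proof. by rewrite lee_fin expR_ge0. Qed.

Lemma gaussk_sym t x y : gaussk t (x, y) = gaussk t (y, x).
Proof. by rewrite /gaussk/= sqdist_sym. Qed.

Lemma pos_def_gaussk t : (0 < t)%R -> pos_def (gaussk t).
Proof.
move=> t0.
have := @pos_def_gauss _ (Rn R n) R _ (index_enum 'I_n) (fun i x => x ord0 i) t t0
  measurable_coord (fun=> 1%R) (measurable_cst _) (fun=> ler01).
by congr pos_def; apply/funext => p; rewrite !mulr1.
Qed.

Definition rieszk (alpha : R) (p : Rn R n * Rn R n) : \bar R :=
  riesz alpha p.1 p.2.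

Lemma energyE alpha (mu nu : bmeasure R n) :
  energy alpha mu nu = kenergy (rieszk alpha) mu nu.
Proof. by []. Qed.

Lemma rieszk_ge0 alpha p : 0 <= rieszk alpha p.
Proof. by rewrite /rieszk /riesz; case: ifP => //; rewrite lee_fin powR_ge0. Qed.

Lemma rieszk_sym alpha x y : rieszk alpha (x, y) = rieszk alpha (y, x).
Proof.
rewrite /rieszk /riesz/= eq_sym /enorm; congr (if _ then _ else (Num.sqrt _ `^ _)%:E).
by apply: eq_bigr => i _; rewrite !mxE -sqrrN opprB.
Qed.

Section mixture.
Variable alpha : R.
Hypothesis alphan : (alpha < n%:R)%R.
Let s : R := ((n%:R - alpha) / 2)%R.
Let s0 : (0 < s)%R. Proof. by rewrite divr_gt0// subr_gt0. Qed.

(** The value of Gamma at [s], where [s] is half of n - alpha so that the power -2s of the distance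
    is the Riesz kernel. *)
Definition rieszc : R := fine (\int[@lebesgue_measure R]_v (laplace s 1 v)%:E).

Lemma rieszcE : rieszc%:E = \int[@lebesgue_measure R]_v (laplace s 1 v)%:E.
Proof.
rewrite fineK// ge0_fin_numE ?integral_laplace_lty//.
by apply: integral_ge0 => v _; rewrite lee_fin laplace_ge0.
Qed.

Lemma rieszc_gt0 : (0 < rieszc)%R.
Proof. by rewrite -lte_fin rieszcE integral_laplace_gt0. Qed.

Definition laplacek (w : (Rn R n * Rn R n) * measurableTypeR R) : \bar R :=
  (laplace s (sqdist w.1.1 w.1.2) w.2)%:E.

Lemma laplacek_ge0 w : 0 <= laplacek w.
Proof. by rewrite lee_fin laplace_ge0. Qed.

Lemma measurable_laplacek : measurable_fun setT laplacek.
Proof.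
apply/measurable_EFinP; apply: measurable_funM;
  apply: (measurableT_comp (@measurable_expR R)).
  by apply: measurable_funM => //; exact: measurable_snd.
apply: measurable_funM.
  apply: measurableT_comp => //; apply: (measurableT_comp (@measurable_expR R)).
  exact: measurable_snd.
exact: (measurableT_comp measurable_sqdist (@measurable_fst _ _ _ _)).
Qed.

Lemma laplacekE v :
  (fun p => laplacek (p, v)) = (fun p => (expR (s * v))%:E * gaussk (expR v) p).
Proof. by apply/funext => p; rewrite -EFinM. Qed.

(** Off the diagonal this is the Gamma integral at the squared distance. On the diagonal both sides
    are infinite, the left one because [rieszc] is positive. *)
Lemma rieszk_mixture p :
  rieszc%:E * rieszk alpha p = \int[@lebesgue_measure R]_v laplacek (p, v).
Proof.
rewrite /laplacek/= /rieszk /riesz; case: eqP => [->|/eqP xy].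
  have -> : sqdist p.2 p.2 = 0%R by apply/eqP; rewrite sqdist_eq0.
  by rewrite integral_laplace0// gt0_muley// lte_fin rieszc_gt0.
have d0 : (0 < enorm (p.1 - p.2)%R)%R.
  rewrite lt_def sqrtr_ge0 andbT; apply: contra xy => /eqP E.
  by rewrite -sqdist_eq0 -sqr_enormB E expr0n.
rewrite -sqr_enormB integral_laplace// muleC -rieszcE; congr (_%:E * _).
by congr (_ `^ _)%R; rewrite /s; field.
Qed.

Lemma rieszkE : rieszk alpha =
  (fun p => (rieszc^-1)%:E * \int[@lebesgue_measure R]_v laplacek (p, v)).
Proof.
apply/funext => p; rewrite -rieszk_mixture muleA -EFinM mulVf ?mul1e//.
by rewrite gt_eqF// rieszc_gt0.
Qed.

Lemma measurable_rieszk : measurable_fun setT (rieszk alpha).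
Proof.
rewrite rieszkE; apply: emeasurable_funM => //.
apply: (@measurable_fun_fubini_tonelli_F _ _ _ _ _ lebesgue_measure laplacek).
  exact: measurable_laplacek.
exact: laplacek_ge0.
Qed.

Lemma pos_def_rieszk : pos_def (rieszk alpha).
Proof.
rewrite rieszkE; apply: pos_def_scale.
- by rewrite invr_ge0 ltW// rieszc_gt0.
- apply: (@measurable_fun_fubini_tonelli_F _ _ _ _ _ lebesgue_measure laplacek).
    exact: measurable_laplacek.
  exact: laplacek_ge0.
- by move=> p; apply: integral_ge0 => v _; exact: laplacek_ge0.
- apply: pos_def_mixture; [exact: measurable_laplacek|exact: laplacek_ge0|] => v.
  rewrite laplacekE; apply: pos_def_scale; [exact: expR_ge0|exact: measurable_gaussk|
    exact: gaussk_ge0|exact/pos_def_gaussk/expR_gt0].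
Qed.

(** Applied to the three energies in [energy_dist2], it exhibits the Riesz distance as a weighted
    integral of Gaussian distances over all scales. *)
Lemma rieszk_energy_mixture (mu nu : {finite_measure set (Rn R n) -> \bar R}) :
  rieszc%:E * kenergy (rieszk alpha) mu nu =
  \int[@lebesgue_measure R]_v ((expR (s * v))%:E * kenergy (gaussk (expR v)) mu nu).
Proof.
rewrite -kenergy_scale ?ltW ?rieszc_gt0//; last 2 first.
- exact: measurable_rieszk.
- exact: rieszk_ge0.
rewrite (_ : (fun p => _) =
    (fun p => \int[@lebesgue_measure R]_v laplacek (p, v))); last first.
  by apply/funext => p; exact: rieszk_mixture.
rewrite kenergy_mixture; [|exact: measurable_laplacek|exact: laplacek_ge0].
apply: eq_integral => v _; rewrite laplacekE kenergy_scale ?expR_ge0//.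
  exact: measurable_gaussk.
exact: gaussk_ge0.
Qed.

End mixture.

End euclidean_kernels.

(** * From the Riesz distance to the Gaussian distance at a given scale *)

Section gauss_from_riesz.
Context {R : realType} {n : nat}.
Local Open Scope ereal_scope.
Implicit Types (mu nu : {finite_measure set (Rn R n) -> \bar R}).

(** With X = expR a * u and c = expR (v - a), the drop from exp(-X) to exp(-cX) is at most (c - 1) X
    exp(-X), hence at most c - 1. The bound does not depend on [u], that is, on the distance of the
    points. *)
Lemma expR_decay (a v delta u : R) : (a <= v)%R -> (v <= a + delta)%R -> (0 <= u)%R ->
  (expR (- expR a * u) <= expR (- expR v * u) + (expR delta - 1))%R.
Proof.
move=> av vad u0.
set X := (expR a * u)%R; set c := expR (v - a).
have X0 : (0 <= X)%R by rewrite mulr_ge0 ?expR_ge0.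
have cv : (expR v * u = c * X)%R by rewrite mulrA -expRD subrK.
have c1 : (1 <= c)%R by rewrite -expR0 ler_expR subr_ge0.
have cd : (c <= expR delta)%R by rewrite ler_expR; lra.
rewrite !mulNr -/X cv.
apply: (@le_trans _ _ (expR (- (c * X)) + (c - 1))%R); last by lra.
have E : (expR (- (c * X)) = expR (- X) * expR (- ((c - 1) * X)))%R.
  by rewrite -expRD; congr expR; ring.
have h1 : (1 - (c - 1) * X <= expR (- ((c - 1) * X)))%R by exact: expR_ge1Dx.
have h2 : (X * expR (- X) <= 1)%R.
  rewrite expRN ler_pdivrMr ?expR_gt0// mul1r.
  by apply: le_trans (expR_ge1Dx X); rewrite lerDr.
have e0 := expR_gt0 (- X).
rewrite E; move: (expR (- X)) (expR (- ((c - 1) * X))) h1 h2 e0 => p q h1 h2 e0.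
nra.
Qed.

Section probability_measures.
Variables mu nu : {finite_measure set (Rn R n) -> \bar R}.
Hypotheses (mu1 : mu setT = 1) (nu1 : nu setT = 1).

Lemma kenergy_gaussk_le1 t : (0 <= t)%R -> kenergy (gaussk t) mu nu <= 1.
Proof.
move=> t0; rewrite -(kenergy_cst 1%R mu nu)//.
apply: le_kenergy => //.
- exact: measurable_gaussk.
- exact: gaussk_ge0.
move=> z; rewrite lee_fin -expR0 ler_expR mulNr oppr_le0.
by rewrite mulr_ge0// sqdist_ge0.
Qed.

Lemma kenergy_gaussk_lty t : (0 <= t)%R -> kenergy (gaussk t) mu nu < +oo.
Proof. by move=> t0; apply: le_lt_trans (kenergy_gaussk_le1 t t0) (ltry _). Qed.

Lemma kenergy_gausskE t : (0 <= t)%R ->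
  kenergy (gaussk t) mu nu = (real_energy (gaussk t) mu nu)%:E.
Proof.
move=> t0; rewrite fineK// ge0_fin_numE ?kenergy_gaussk_lty//.
by apply: kenergy_ge0 => z; exact: gaussk_ge0.
Qed.

Lemma real_energy_gaussk_le (a v : R) : (a <= v)%R ->
  (real_energy (gaussk (expR v)) mu nu <= real_energy (gaussk (expR a)) mu nu)%R.
Proof.
move=> av.
have : kenergy (gaussk (expR v)) mu nu <= kenergy (gaussk (expR a)) mu nu.
  apply: le_kenergy; [exact: measurable_gaussk|exact: measurable_gaussk|exact: gaussk_ge0|].
  by move=> z; rewrite lee_fin ler_expR !mulNr lerN2 ler_wpM2r ?sqdist_ge0// ler_expR.
by rewrite !kenergy_gausskE ?expR_ge0// lee_fin.
Qed.

(** The error in [expR_decay] is a constant, and both measures have mass one, so it passes unchanged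
    to the energies. *)
Lemma real_energy_gaussk_ge (a v delta : R) : (a <= v)%R -> (v <= a + delta)%R ->
  (real_energy (gaussk (expR a)) mu nu <=
   real_energy (gaussk (expR v)) mu nu + (expR delta - 1))%R.
Proof.
move=> av vad.
have d1 : (0 <= expR delta - 1)%R.
  by rewrite subr_ge0 -expR0 ler_expR; lra.
have : kenergy (gaussk (expR a)) mu nu <=
    kenergy (gaussk (expR v)) mu nu + (expR delta - 1)%:E.
  rewrite -[X in _ <= _ + X](kenergy_cst _ mu nu)// -kenergyD//; last 2 first.
  - exact: measurable_gaussk.
  - exact: gaussk_ge0.
  apply: le_kenergy; [exact: measurable_gaussk| |exact: gaussk_ge0|].
    by apply: emeasurable_funD => //; exact: measurable_gaussk.
  by move=> z; rewrite -EFinD lee_fin expR_decay// sqdist_ge0.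
by rewrite !kenergy_gausskE ?expR_ge0// -EFinD lee_fin.
Qed.

End probability_measures.

(** A Chebyshev argument: a surplus of [w * q] of [P] over [N] on an interval of length [delta]
    contributes [w * q * delta] to the total surplus [p - r]. Keeping [P] and [N] apart confines the
    integration to nonnegative functions. *)
Lemma le_integral_gap (P N : R -> R) (a delta q w p r : R) :
  (0 < delta)%R -> (0 < w)%R -> measurable_fun setT P -> measurable_fun setT N ->
  (forall v, 0 <= N v <= P v)%R ->
  (forall v, a <= v <= a + delta -> N v + w * q <= P v)%R ->
  \int[@lebesgue_measure R]_v (P v)%:E = p%:E ->
  \int[@lebesgue_measure R]_v (N v)%:E = r%:E ->
  (q <= (p - r) / (w * delta))%R.
Proof.
move=> delta0 w0 mP mN NP gap IP IN.
have N0 v : (0 <= N v)%R by case/andP: (NP v).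
have P0 v : (0 <= P v)%R by case/andP: (NP v) => h1 h2; exact: le_trans h1 h2.
have mP' : measurable_fun setT (EFin \o P) by exact/measurable_EFinP.
have mN' : measurable_fun setT (EFin \o N) by exact/measurable_EFinP.
have rp : (r <= p)%R.
  rewrite -lee_fin -IP -IN; apply: ge0_le_integral => //.
  - by move=> v _; rewrite lee_fin.
  - by move=> v _; rewrite lee_fin; case/andP: (NP v).
have [q0|q0] := leP q 0%R.
  by apply: le_trans q0 _; rewrite divr_ge0 ?subr_ge0// ltW// mulr_gt0.
rewrite ler_pdivlMr ?mulr_gt0// lerBrDl.
pose c := (q * w)%R.
have c0 : (0 <= c)%R by rewrite mulr_ge0// ltW.
have mI : measurable_fun setT (fun v : R => (c * \1_(`[a, (a + delta)%R]%classic) v)%:E).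
  by apply/measurable_EFinP; apply: measurable_funM.
have I0 v : 0 <= (c * \1_(`[a, (a + delta)%R]%classic) v)%:E.
  by rewrite lee_fin mulr_ge0.
have : \int[@lebesgue_measure R]_v
    ((N v)%:E + (c * \1_(`[a, (a + delta)%R]%classic) v)%:E) <=
    \int[@lebesgue_measure R]_v (P v)%:E.
  apply: ge0_le_integral => //.
  - by move=> v _; apply: adde_ge0 => //; rewrite lee_fin.
  - exact: emeasurable_funD.
  move=> v _; rewrite -EFinD lee_fin indicE; case: (boolP (v \in _)) => [|_].
    by rewrite inE/= in_itv/= mulr1 /c mulrC; exact: gap.
  by rewrite mulr0 addr0; case/andP: (NP v).
rewrite ge0_integralD//; last by move=> v _; rewrite lee_fin.
rewrite IP IN.
under eq_integral do rewrite EFinM.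
rewrite ge0_integralZl_EFin//; last by apply/measurable_EFinP.
rewrite integral_indic//= setIT lebesgue_measure_itv/= lte_fin ltrDl delta0.
rewrite -EFinB -EFinM -EFinD lee_fin /c.
by have -> : (q * w * (a + delta - a) = q * (w * delta))%R by ring.
Qed.

Variable alpha : R.
Hypothesis alphan : (alpha < n%:R)%R.
Let s : R := ((n%:R - alpha) / 2)%R.

(* On [[a, a + delta]] the Gaussian distance differs little from its value at
   [a], and the Riesz distance is an average of Gaussian distances. *)
Lemma gaussk_dist2_bound mu nu (a delta : R) : mu setT = 1 -> nu setT = 1 ->
  kenergy (rieszk alpha) mu mu < +oo -> kenergy (rieszk alpha) nu nu < +oo ->
  (0 < delta)%R ->
  (energy_dist2 (gaussk (expR a)) mu nu <= 2 * (expR delta - 1) +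
   rieszc (n := n) alpha * energy_dist2 (rieszk alpha) mu nu / (expR (s * a) * delta))%R.
Proof.
move=> mu1 nu1 imu inu delta0.
have r0 := rieszk_ge0 (n := n) alpha.
have pr := pos_def_rieszk alpha alphan (n := n).
have imn := kenergy_cross_lty _ r0 pr _ _ imu inu.
have s0 : (0 < s)%R by rewrite divr_gt0// subr_gt0.
have [w wE] : exists w : R -> R, forall v, w v = expR (s * v).
  by exists (fun v => expR (s * v)).
have gE (m1 m2 : {finite_measure set (Rn R n) -> \bar R}) :
    m1 setT = 1 -> m2 setT = 1 ->
    kenergy (rieszk alpha) m1 m2 < +oo ->
    exists g : R -> R, [/\ (forall v, g v = real_energy (gaussk (expR v)) m1 m2),
      (forall v, 0 <= g v)%R,
      measurable_fun setT (fun v => w v * g v)%R &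
      \int[@lebesgue_measure R]_v (w v * g v)%:E =
      (rieszc (n := n) alpha * real_energy (rieszk alpha) m1 m2)%:E].
  move=> h1 h2 h12; have -> : w = (fun v => expR (s * v)) by exact/funext.
  have E v : ((expR (s * v))%:E * kenergy (gaussk (expR v)) m1 m2 =
      (expR (s * v) * real_energy (gaussk (expR v)) m1 m2)%:E).
    by rewrite kenergy_gausskE ?expR_ge0.
  exists (fun v => real_energy (gaussk (expR v)) m1 m2); split => //.
  - by move=> v; apply/fine_ge0/kenergy_ge0 => z; exact: gaussk_ge0.
  - apply/measurable_EFinP.
    have := measurable_kenergy_mixture _ _ (laplacek alpha) m1 m2
      (measurable_laplacek alpha) (laplacek_ge0 alpha).
    apply: eq_measurable_fun => v _.
    rewrite laplacekE kenergy_scale ?expR_ge0//; first exact: measurable_gaussk.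
    exact: gaussk_ge0.
  - rewrite EFinM -(kenergyE _ r0 _ _ h12) rieszk_energy_mixture//.
    by apply: eq_integral => v _; rewrite E.
have [g1 [g1E g10 mg1 Ig1]] := gE _ _ mu1 mu1 imu.
have [g2 [g2E g20 mg2 Ig2]] := gE _ _ nu1 nu1 inu.
have [g3 [g3E g30 mg3 Ig3]] := gE _ _ mu1 nu1 imn.
have psd v : (0 <= g1 v + g2 v - 2 * g3 v)%R.
  rewrite g1E g2E g3E.
  exact: (energy_dist2_ge0 _ (gaussk_ge0 (expR v))
    (pos_def_gaussk (expR v) (expR_gt0 v)) mu nu
    (kenergy_gaussk_lty mu mu mu1 mu1 _ (expR_ge0 v))
    (kenergy_gaussk_lty nu nu nu1 nu1 _ (expR_ge0 v))).
have h1 v (av : (a <= v)%R) (vd : (v <= a + delta)%R) : (g1 a <= g1 v + (expR delta - 1))%R.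
  by rewrite !g1E; exact: real_energy_gaussk_ge.
have h2 v (av : (a <= v)%R) (vd : (v <= a + delta)%R) : (g2 a <= g2 v + (expR delta - 1))%R.
  by rewrite !g2E; exact: real_energy_gaussk_ge.
have h3 v (av : (a <= v)%R) : (g3 v <= g3 a)%R.
  by rewrite !g3E; exact: real_energy_gaussk_le.
have DE : energy_dist2 (gaussk (expR a)) mu nu = (g1 a + g2 a - 2 * g3 a)%R.
  by rewrite /energy_dist2 g1E g2E g3E.
have RE : (rieszc (n := n) alpha * energy_dist2 (rieszk alpha) mu nu =
    (rieszc (n := n) alpha * real_energy (rieszk alpha) mu mu +
     rieszc (n := n) alpha * real_energy (rieszk alpha) nu nu) -
    2 * (rieszc (n := n) alpha * real_energy (rieszk alpha) mu nu))%R.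
  by rewrite /energy_dist2; ring.
rewrite DE RE; move: Ig1 Ig2 Ig3.
move: (_ * real_energy _ mu mu)%R (_ * real_energy _ nu nu)%R (_ * real_energy _ mu nu)%R.
move=> x1 x2 x3 Ig1 Ig2 Ig3.
have w0 v : (0 < w v)%R by rewrite wE expR_gt0.
have wa v : (a <= v)%R -> (w a <= w v)%R.
  by move=> av; rewrite !wE ler_expR; apply: ler_wpM2l => //; exact: ltW.
rewrite -wE.
rewrite -lerBlDl.
(* [P] collects the two self-energies and [N] twice the mutual energy, so [P - N] is the weight
   times the Gaussian distance at scale [v], and it integrates to [rieszc] times the Riesz
   distance. *)
apply: (@le_integral_gap (fun v => w v * g1 v + w v * g2 v)%R
  (fun v => 2 * (w v * g3 v))%R a) => //.
- exact: measurable_funD.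
- exact: measurable_funM.
- move=> v; have := mulr_ge0 (ltW (w0 v)) (psd v).
  have := mulr_ge0 (ltW (w0 v)) (g30 v).
  by move=> ? ?; apply/andP; split; lra.
(* From [a] to [v] each self-energy loses at most [expR delta - 1], while the mutual energy can only
   decrease, which is favourable. Hence the Gaussian distance at [v] is at least [q]; the weight,
   being increasing, is at least [w a]. *)
- move=> v /andP[av vd].
  have := mulr_ge0 (ltW (w0 v)) (psd v).
  have := h1 v av vd; have := h2 v av vd; have := h3 v av; have := wa v av.
  have := w0 a; have := psd v; move: (expR delta) (w a) (w v) => ed y z.
  move: (g1 a) (g2 a) (g3 a) (g1 v) (g2 v) (g3 v); clear => a1 a2 a3 v1 v2 v3.
  move=> G0 y0 yz H3 H2 H1 zG.
  set q := (_ - _)%R; set G := (v1 + v2 - 2 * v3)%R in G0 zG.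
  have qG : (q <= G)%R by rewrite /q /G; lra.
  suff : (y * q <= z * G)%R by rewrite /G; lra.
  have [q0|q0] := leP q 0%R.
    by apply: le_trans zG; rewrite mulr_ge0_le0// ltW.
  apply: (@le_trans _ _ (z * q)%R); first by rewrite ler_pM2r.
  by rewrite ler_pM2l//; exact: lt_le_trans yz.
- under eq_integral do rewrite EFinD.
  rewrite ge0_integralD//; first by rewrite Ig1 Ig2.
  + by move=> v _; rewrite lee_fin mulr_ge0// ltW.
  + exact/measurable_EFinP.
  + by move=> v _; rewrite lee_fin mulr_ge0// ltW.
  + exact/measurable_EFinP.
- under eq_integral do rewrite EFinM.
  rewrite ge0_integralZl_EFin//; first by rewrite Ig3.
  + by move=> v _; rewrite lee_fin mulr_ge0// ltW.
  + exact/measurable_EFinP.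
Qed.

End gauss_from_riesz.

(** * The algebra and lattice of uniform limits of combinations of Gaussians *)

Section gaussian_span.
Context {R : realType} {n : nat}.
Implicit Types (x y z : Rn R n) (f g : Rn R n -> R).

(** Uniform limits are a constructor, so boundedness, products, measurability and convergence of
    integrals all follow by induction. The rate 1 / (k + 1) is a mere normalization, removed by
    [gspan_unif]. *)
Inductive gspan : (Rn R n -> R) -> Prop :=
| gspan_gauss t y : 0 < t -> gspan (fun x => expR (- t * sqdist x y))
| gspanD f g : gspan f -> gspan g -> gspan (fun x => f x + g x)
| gspanZ c f : gspan f -> gspan (fun x => c * f x)
| gspan_cvg (g_ : nat -> Rn R n -> R) f : (forall k, gspan (g_ k)) ->
    (forall k x, `|f x - g_ k x| <= k.+1%:R^-1) -> gspan f.

Lemma gspan_unif f :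
  (forall e, 0 < e -> exists2 g, gspan g & forall x, `|f x - g x| <= e) -> gspan f.
Proof.
move=> H.
have /choice[g_ Hg] : forall k : nat, exists g, gspan g /\ forall x, `|f x - g x| <= k.+1%:R^-1.
  by move=> k; have [g Hg fg] := H k.+1%:R^-1 ltac:(by []); exists g.
by apply: (gspan_cvg g_) => k; case: (Hg k).
Qed.

Lemma gspan_bounded f : gspan f -> exists2 C, 0 < C & forall x, `|f x| <= C.
Proof.
elim=> {f} [t y t0|f g _ [C C0 fC] _ [D D0 gD]|c f _ [C C0 fC]|g_ f _ IH fg].
- exists 1 => // x; rewrite ger0_norm ?expR_ge0// -expR0 ler_expR mulNr oppr_le0.
  by rewrite mulr_ge0 ?sqdist_ge0// ltW.
- exists (C + D) => [|x]; first exact: addr_gt0.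
  by apply: le_trans (ler_normD _ _) _; exact: lerD.
- exists ((`|c| + 1) * C) => [|x]; first by rewrite mulr_gt0// ltr_wpDl.
  by rewrite normrM ler_pM// lerDl.
- have [C C0 gC] := IH 0; exists (1 + C) => [|x]; first exact: addr_gt0.
  rewrite -(subrK (g_ 0 x) (f x)); apply: le_trans (ler_normD _ _) _.
  by apply: lerD => //; have := fg 0 x; rewrite invr1.
Qed.

Lemma exists_invS_le (e : R) : 0 < e -> exists k : nat, k.+1%:R^-1 <= e.
Proof.
move=> e0; exists (Num.truncn e^-1).
rewrite -[leRHS]invrK lef_pV2 ?posrE ?invr_gt0//.
by apply: ltW; rewrite truncnS_gt.
Qed.

Lemma gspan_ext f g : gspan f -> f =1 g -> gspan g.
Proof. by move=> Hf /funext <-. Qed.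

Lemma gspan0 : gspan (fun=> 0).
Proof.
apply: gspan_ext (gspanZ 0 _ (gspan_gauss 1 (0 : 'rV[R]_n) ltr01)) _ => y.
by rewrite mul0r.
Qed.

(** Completing the square: t |x - y|^2 + s |x - z|^2 equals (t + s) |x - w|^2 + (t s / (t + s)) |y -
    z|^2, where [w] is the barycentre of [y] and [z] with weights [t] and [s]. *)
Lemma gaussM t s y z : 0 < t -> 0 < s -> exists w c, forall x,
  expR (- t * sqdist x y) * expR (- s * sqdist x z) =
  c * expR (- (t + s) * sqdist x w).
Proof.
move=> t0 s0; have ts : t + s != 0 by rewrite gt_eqF// addr_gt0.
exists (\row_i ((t * y ord0 i + s * z ord0 i) / (t + s))).
exists (expR (- (t * s / (t + s)) * sqdist y z)) => x.
rewrite -!expRD; congr expR.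
rewrite /sqdist !big_distrr/= -!big_split/=; apply: eq_bigr => i _.
by rewrite mxE; field.
Qed.

(** Induction on the first factor and, when it is a single Gaussian, on the second. Uniform limits
    survive multiplication because every member is bounded. *)
Lemma gspanM f g : gspan f -> gspan g -> gspan (fun x => f x * g x).
Proof.
move=> Hf; elim: Hf g => {f} [t y t0|f h _ IHf _ IHh|c f _ IHf|f_ f _ IH ff] g Hg.
- elim: Hg => {g} [s z s0|f g _ IHf _ IHg|c f _ IHf|f_ f _ IH ff].
  + have [w [c E]] := gaussM t s y z t0 s0.
    apply: gspan_ext (gspanZ c _ (gspan_gauss (t + s) w _)) _.
      exact: addr_gt0.
    by move=> x; rewrite E.
  + by apply: gspan_ext (gspanD _ _ IHf IHg) _ => x; rewrite mulrDr.
  + by apply: gspan_ext (gspanZ c _ IHf) _ => x; rewrite mulrCA.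
  + apply: (gspan_cvg _ _ IH) => k x; rewrite -mulrBr normrM.
    apply: le_trans (ff k x); rewrite ger0_norm ?expR_ge0// ler_piMl//.
    by rewrite -expR0 ler_expR mulNr oppr_le0 mulr_ge0 ?sqdist_ge0// ltW.
- by apply: gspan_ext (gspanD _ _ (IHf _ Hg) (IHh _ Hg)) _ => x; rewrite mulrDl.
- by apply: gspan_ext (gspanZ c _ (IHf _ Hg)) _ => x; rewrite mulrA.
- have [C C0 gC] := gspan_bounded _ Hg; apply: gspan_unif => e e0.
  have [k ke] := exists_invS_le (e / C) (divr_gt0 e0 C0).
  exists (fun x => f_ k x * g x); first exact: IH.
  move=> x; rewrite -mulrBl normrM.
  rewrite -[leRHS](divfK (lt0r_neq0 C0)); apply: ler_pM => //.
  exact: le_trans (ff k x) ke.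
Qed.

(* The classical recursion [u := u + (t ^ 2 - u ^ 2) / 2] increases to [|t|] for
   [|t| <= 1], and it produces polynomials without constant term. *)
Fixpoint abs_approx (k : nat) (t : R) : R :=
  if k is k'.+1 then abs_approx k' t + (t ^+ 2 - abs_approx k' t ^+ 2) / 2 else 0.

Lemma abs_approxP (k : nat) (t : R) : `|t| <= 1 ->
  0 <= abs_approx k t <= `|t| /\ (`|t| - abs_approx k t) * (1 + k%:R / 2) <= 1.
Proof.
move=> t1; elim: k => [|k [/andP[u0 ut] IH]] /=.
  by rewrite lexx normr_ge0 subr0 mul0r addr0 mulr1.
rewrite -(real_normK (num_real t)) -[k.+1%:R]natr1.
move: (abs_approx k t) (`|t|) t1 (normr_ge0 t) u0 ut IH (ler0n R k) => u a a1 a0 u0 ua IH.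
move: (k%:R) IH => q IH q0.
have d'E : a - (u + (a ^+ 2 - u ^+ 2) / 2) = (a - u) * (1 - (a + u) / 2) by field.
split.
  rewrite -(subr_ge0 _ a) d'E; apply/andP; split; last by rewrite mulr_ge0; lra.
  by rewrite addr_ge0// divr_ge0// subr_sqr mulr_ge0; lra.
rewrite d'E; set d := a - u in IH *.
(* As [u >= 0], the sum [a + u] is at least the error [d], so one step multiplies [d] by at most 1 -
   d / 2. With the induction hypothesis the product is at most (1 - d / 2) (1 + d / 2) <= 1. *)
apply: (@le_trans _ _ (d * (1 - d / 2) * (1 + (q + 1) / 2))).
  rewrite ler_wpM2r//; first lra.
  by rewrite ler_wpM2l /d//; lra.
have -> : d * (1 - d / 2) * (1 + (q + 1) / 2) =
  (1 - d / 2) * (d * (1 + q / 2) + d / 2) by field.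
apply: (@le_trans _ _ ((1 - d / 2) * (1 + d / 2))).
  by rewrite ler_wpM2l /d// ?lerD2r//; lra.
have := sqr_ge0 d; lra.
Qed.

Lemma gspan_abs f : gspan f -> gspan (fun x => `|f x|).
Proof.
move=> Hf; have [C C0 fC] := gspan_bounded _ Hf.
pose h x := C^-1 * f x.
have Hh : gspan h by exact: gspanZ.
have h1 x : `|h x| <= 1.
  by rewrite /h normrM gtr0_norm ?invr_gt0// ler_pdivrMl// mulr1.
suff Hah : gspan (fun x => `|h x|).
  apply: gspan_ext (gspanZ C _ Hah) _ => x.
  by rewrite /h normrM gtr0_norm ?invr_gt0// mulVKf// gt_eqF.
have Hu k : gspan (fun x => abs_approx k (h x)).
  elim: k => [|k IH] /=.
    by apply: gspan_ext (gspanZ 0 _ Hf) _ => x; rewrite mul0r.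
  apply: gspan_ext (gspanD _ _ IH (gspanZ 2^-1 _
    (gspanD _ _ (gspanM _ _ Hh Hh) (gspanZ (-1) _ (gspanM _ _ IH IH))))) _ => x.
  by rewrite /=; field.
(* At the index 2k the factor 1 + 2k / 2 of the error bound is exactly k + 1, the rate that
   [gspan_cvg] asks for. *)
apply: (gspan_cvg (fun k x => abs_approx (2 * k)%N (h x))) => // k x.
have [/andP[u0 ut]] := abs_approxP (2 * k)%N (h x) (h1 x).
rewrite natrM mulrAC divff// mul1r => H; rewrite ger0_norm ?subr_ge0//.
by rewrite -[leRHS]mul1r ler_pdivlMr// -[k.+1%:R]natr1 (addrC k%:R).
Qed.

Lemma gspan_max f g : gspan f -> gspan g -> gspan (fun x => Num.max (f x) (g x)).
Proof.
move=> Hf Hg.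
have Hfg : gspan (fun x => f x - g x).
  by apply: gspan_ext (gspanD _ _ Hf (gspanZ (-1) _ Hg)) _ => x; rewrite mulN1r.
apply: gspan_ext (gspanZ 2^-1 _ (gspanD _ _ (gspanD _ _ Hf Hg) (gspan_abs _ Hfg))) _ => x.
by rewrite maxr_absE mulrC.
Qed.

Lemma gspan_bigmax (I : Type) (s : seq I) (F : I -> Rn R n -> R) :
  (forall i, gspan (F i)) -> gspan (fun x => \big[Num.max/0]_(i <- s) F i x).
Proof.
move=> HF; elim: s => [|i s IH].
  by apply: gspan_ext gspan0 _ => x; rewrite big_nil.
by apply: gspan_ext (gspan_max _ _ (HF i) IH) _ => x; rewrite big_cons.
Qed.

Lemma gspan_measurable f : gspan f -> measurable_fun setT f.
Proof.
elim=> {f} [t y t0|f g _ mf _ mg|c f _ mf|g_ f _ IH fg].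
- apply: (measurableT_comp (@measurable_expR R)); apply: measurable_funM => //.
  have := measurableT_comp (@measurable_sqdist R n) (@pair2_measurable _ _ _ _ y).
  exact.
- exact: measurable_funD.
- exact: measurable_funM.
- apply: (@measurable_fun_cvg _ _ _ setT g_ f) => // x _.
  apply/cvgrPdist_le => e e0.
  have [k ke] := exists_invS_le e e0.
  exists k => // j /= kj; apply: le_trans (fg j x) _; apply: le_trans ke.
  by rewrite lef_pV2 ?posrE// ler_nat.
Qed.

End gaussian_span.

(** * Continuous functions of compact support are uniform limits of Gaussian combinations *)

Section compactly_supported_functions.
Context {R : realType} {n : nat}.
Implicit Types (phi : 'rV[R]_n -> R).

Lemma continuous_sqdist (y : 'rV[R]_n) : continuous (fun x : 'rV[R]_n => sqdist x y).
Proof.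
apply: continuous_big => [z|i _ x]; first exact: (@add_continuous R^o z).
have c : (fun z : 'rV[R]_n => z ord0 i) @ x --> x ord0 i by exact: coord_continuous.
have h : (fun z : 'rV[R]_n => z ord0 i - y ord0 i) @ x --> x ord0 i - y ord0 i.
  exact: cvgB c (cvg_cst _).
exact: (cvgM h h).
Qed.

(* For [x] near [y] the bump lies below [phi y], which is close to [phi x];
   away from [y] it is small because [t] is large. *)
Lemma gauss_bump phi (e : R) (y : 'rV[R]_n) : 0 < e -> continuous phi ->
  (forall x, 0 <= phi x) -> exists2 t, 0 < t &
  forall x : 'rV[R]_n, phi y * expR (- t * sqdist x y) <= phi x + e.
Proof.
move=> e0 cphi phi0.
have /cvgrPdist_le/(_ _ e0) := cphi y; case/nbhs_ballP => d /= d0 yd.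
(* Outside the ball of radius [d] the exponent is then at least [phi y / e], and exp(X) >= X brings
   the bump below [e]. The added 1 keeps [t] positive when [phi y] vanishes. *)
exists ((phi y / e + 1) / d ^+ 2).
  by rewrite divr_gt0// ?exprn_gt0// ltr_wpDl// divr_ge0// ltW.
move=> x; set t := _ / d ^+ 2.
have t0 : 0 <= t.
  by rewrite divr_ge0// ?exprn_ge0 ?addr_ge0 ?divr_ge0// ltW.
have [yx|yx] := pselect (ball y d x).
  have := yd _ yx; rewrite ler_norml => /andP[_]; rewrite lerBlDr addrC => h.
  apply: le_trans h; rewrite ler_piMr//.
  by rewrite -expR0 ler_expR mulNr oppr_le0 mulr_ge0 ?sqdist_ge0.
apply: (@le_trans _ _ e); last by rewrite lerDr.
have dxy : d ^+ 2 <= sqdist x y.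
  (* Balls are those of the sup norm: outside of one, a single coordinate already differs by at
     least [d]. *)
  have [i di] : exists i : 'I_n, d <= `|y ord0 i - x ord0 i|.
    apply/existsP; apply: contra_notT yx => /existsPn H.
    by split=> // i j; rewrite (ord1 i) /ball/= ltNge; exact: H.
  rewrite /sqdist (bigD1 i)//=; apply: ler_wpDr.
    by apply: sumr_ge0 => j _; exact: sqr_ge0.
  by rewrite -[leRHS]real_normK ?num_real// distrC ler_sqr ?nnegrE // ltW.
rewrite mulNr expRN ler_pdivrMr ?expR_gt0//.
have h1 : phi y / e <= t * sqdist x y.
  apply: (@le_trans _ _ (t * d ^+ 2)); last by rewrite ler_wpM2l.
  by rewrite divfK ?lerDl// gt_eqF// exprn_gt0.
apply: (@le_trans _ _ (e * (phi y / e))).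
  by rewrite mulrCA divff ?mulr1// gt_eqF.
rewrite ler_pM2l//; apply: le_trans h1 _.
by apply: le_trans (expR_ge1Dx _); rewrite lerDr.
Qed.

(** The approximant is a finite maximum of bumps of height [phi y] at [y]. Each bump lies below
    [phi + e] everywhere; compactness of the support selects finitely many such that one of them
    exceeds [phi - e] at each point of it. Where [phi] vanishes, the lower bound holds because the
    maximum starts at 0. *)
Lemma gspan_Cc_ge0 phi : continuous phi -> compact (closure [set x | phi x != 0]) ->
  (forall x, 0 <= phi x) -> gspan (phi : Rn R n -> R).
Proof.
move=> cphi Kphi phi0; apply: gspan_unif => e e0.
have /choice[t_ Ht] : forall y : 'rV[R]_n, exists t, 0 < t /\
    forall x : 'rV[R]_n, phi y * expR (- t * sqdist x y) <= phi x + e.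
  by move=> y; have [t t0 H] := gauss_bump phi e y e0 cphi phi0; exists t.
pose h (y x : 'rV[R]_n) := phi y * expR (- t_ y * sqdist x y).
pose U (y : 'rV[R]_n) := [set x | phi x - h y x < e].
have Uopen y : open (U y).
  have ch : continuous (fun x => phi x - h y x).
    move=> x.
    have c1 : (fun z : 'rV[R]_n => - t_ y * sqdist z y) @ x --> - t_ y * sqdist x y.
      exact: cvgM (cvg_cst _) (continuous_sqdist y x).
    have c2 : (fun z : 'rV[R]_n => expR (- t_ y * sqdist z y)) @ x -->
        expR (- t_ y * sqdist x y).
      by apply: cvg_comp c1 _; exact: continuous_expR.
    exact: (cvgB (cphi x) (cvgM (cvg_cst (phi y)) c2)).
  by move/continuousP : ch => /(_ [set r | r < e]); apply; exact: open_lt.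
move: Kphi; rewrite compact_cover => /(_ _ setT U (fun y _ => Uopen y)) [].
  move=> x _; exists x => //; rewrite /U/= /h.
  have -> : sqdist x x = 0 by apply/eqP; rewrite sqdist_eq0.
  by rewrite mulr0 expR0 mulr1 subrr.
move=> D' _ cov.
exists (fun x => \big[Num.max/0]_(y <- finmap.enum_fset D') h y x).
  apply: gspan_bigmax => y; apply: gspanZ; apply: gspan_gauss.
  by case: (Ht y).
move=> x; rewrite ler_norml; apply/andP; split.
  rewrite lerBrDl addrC -lerBrDl opprK.
  apply: bigmax_le => [|y _]; first by rewrite addr_ge0// ltW.
  by have [_] := Ht y; exact.
rewrite lerBlDr.
have [px0|px0] := eqVneq (phi x) 0.
  rewrite px0 addr_ge0//; first exact: ltW.
  exact: bigmax_ge_id.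
have [] := cov x; first exact: subset_closure.
move=> y /= yD; rewrite /U/= => Uxy.
apply: (@le_trans _ _ (e + h y x)); first by rewrite -lerBlDr ltW.
rewrite lerD2l; have {yD} : y \in finmap.enum_fset D' by [].
elim: (finmap.enum_fset D') => // z s IH; rewrite inE big_cons le_max.
by move=> /orP[/eqP <-|/IH ->]; rewrite ?lexx ?orbT.
Qed.

Lemma gspan_Cc phi : continuous phi -> compact (closure [set x | phi x != 0]) ->
  gspan (phi : Rn R n -> R).
Proof.
move=> cphi Kphi.
have Hmax (psi : 'rV[R]_n -> R) : continuous psi ->
    [set x | psi x != 0] `<=` [set x | phi x != 0] ->
    gspan (fun x : Rn R n => Num.max (psi x) 0).
  move=> cpsi sub; apply: gspan_Cc_ge0 => [x||x]; last by rewrite le_max lexx orbT.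
    exact: (continuous_max (cpsi x) (@cst_continuous _ _ (0 : R^o) x)).
  apply: (subclosed_compact _ Kphi); first exact: closed_closure.
  apply: closureS => x /=; apply: contraNneq => /=.
  have [->|/sub/=] := eqVneq (psi x) 0; first by rewrite maxxx.
  by move=> + H; rewrite H eqxx.
have H1 := Hmax phi cphi (fun x => id).
have H2 : gspan (fun x : Rn R n => Num.max (- phi x) 0).
  apply: Hmax => [x|x /=]; last by rewrite oppr_eq0.
  exact: (cvgN (cphi x)).
apply: gspan_ext (gspanD _ _ H1 (gspanZ (-1) _ H2)) _ => x.
by rewrite mulN1r; case: (leP (phi x)) => h; case: leP => h'; lra.
Qed.

End compactly_supported_functions.

(** * Strong convergence of probability measures implies vague convergence *)

Section energy_convergence_is_vague.
Context {R : realType} {n : nat} (alpha : R).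
Hypothesis alphan : alpha < n%:R.
Variables (lam_ : nat -> {finite_measure set (Rn R n) -> \bar R})
  (lam : {finite_measure set (Rn R n) -> \bar R}).
Hypotheses (lam1_ : forall j, lam_ j setT = 1%E) (lam1 : lam setT = 1%E)
  (ilam_ : forall j, (kenergy (rieszk alpha) (lam_ j) (lam_ j) < +oo)%E)
  (ilam : (kenergy (rieszk alpha) lam lam < +oo)%E)
  (dlam : (fun j => energy_dist2 (rieszk alpha) (lam_ j) lam) @ \oo --> (0 : R)).

Lemma cvg_gaussk_dist2 (t : R) : 0 < t ->
  (fun j => energy_dist2 (gaussk t) (lam_ j) lam) @ \oo --> (0 : R).
Proof.
move=> t0; rewrite -(lnK t0); set a := ln t.
apply/cvgrPdist_le => e e0.
(* This makes 2 (expR delta - 1) equal to e / 2. With [delta] fixed, the other half is left for the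
   Riesz term, which tends to 0. *)
pose delta := ln (1 + e / 4).
have e4 : 1 < 1 + e / 4 by rewrite ltrDl divr_gt0.
have d0 : 0 < delta by rewrite ln_gt0.
have ed : expR delta = 1 + e / 4 by rewrite lnK// posrE; lra.
set w := expR ((n%:R - alpha) / 2 * a).
have w0 : 0 < w by exact: expR_gt0.
have c0 : 0 < rieszc (n := n) alpha by exact: rieszc_gt0.
have wc0 : 0 < e / 2 * (w * delta) / rieszc (n := n) alpha.
  by rewrite divr_gt0// mulr_gt0// ?divr_gt0// mulr_gt0.
move/cvgrPdist_le : dlam => /(_ _ wc0); apply: filterS => j.
rewrite sub0r normrN => H; rewrite sub0r normrN.
have D0 : 0 <= energy_dist2 (gaussk (expR a)) (lam_ j) lam.
  apply: energy_dist2_ge0; first exact: gaussk_ge0.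
  - by apply: pos_def_gaussk; exact: expR_gt0.
  - by apply: kenergy_gaussk_lty => //; exact: expR_ge0.
  - by apply: kenergy_gaussk_lty => //; exact: expR_ge0.
rewrite ger0_norm//.
apply: le_trans (gaussk_dist2_bound alpha alphan (lam_ j) lam a delta _ _ _ _ d0) _ => //.
rewrite ed -/w.
have eE : 2 * (1 + e / 4 - 1) + e / 2 = e by field.
rewrite -[leRHS]eE lerD2l ler_pdivrMr ?mulr_gt0// mulrC -ler_pdivlMr//.
exact: le_trans (ler_norm _) H.
Qed.

Lemma Rintegral_gauss (m : {finite_measure set (Rn R n) -> \bar R}) (t : R) (y : Rn R n) :
  \int[m]_(x in setT) expR (- t * sqdist x y) = real_energy (gaussk t) m (\d_y).
Proof.
congr fine; apply: eq_integral => x _.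
rewrite integral_dirac ?diracT ?mul1e//.
by apply: measurable_ksection; exact: measurable_gaussk.
Qed.

(** The Dirac measure at [y] has Gaussian energy at most one, so it is admissible as [tau] in the
    Cauchy-Schwarz bound. Parameter [e] and distance at most e^2 give 2 e r <= 2 e^2 for the
    difference r of the integrals. *)
Lemma cvg_Rintegral_gauss (t : R) (y : Rn R n) : 0 < t ->
  (fun j => \int[lam_ j]_(x in setT) expR (- t * sqdist x y)) @ \oo -->
  \int[lam]_(x in setT) expR (- t * sqdist x y).
Proof.
move=> t0; apply/cvgrPdist_le => e e0.
move/cvgrPdist_le : (cvg_gaussk_dist2 t t0) => /(_ _ (exprn_gt0 2 e0)).
apply: filterS => j; rewrite sub0r normrN => H.
rewrite distrC !Rintegral_gauss.
have dy1 : (\d_y : {measure set (Rn R n) -> \bar R}) setT = 1%E by exact: diracT.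
have tge := ltW t0.
have := energy_dist2_bound (gaussk t) (measurable_gaussk t) (gaussk_ge0 t)
  (gaussk_sym t) (pos_def_gaussk t t0) (lam_ j) lam (\d_y) e (ltW e0)
  (kenergy_gaussk_lty _ _ (lam1_ j) (lam1_ j) _ tge)
  (kenergy_gaussk_lty _ _ lam1 lam1 _ tge)
  (kenergy_gaussk_lty _ _ dy1 dy1 _ tge).
have := kenergy_gaussk_le1 _ _ dy1 dy1 _ tge.
rewrite (kenergy_gausskE _ _ dy1 dy1 _ tge) lee_fin.
move: H; move: (energy_dist2 _ _ _) (real_energy _ (\d_y) (\d_y)).
move: (real_energy _ (lam_ j) _ - real_energy _ lam _) => r0 D q DD q1; set r := `|r0| => H; have De := le_trans (ler_norm D) DD.
suff : e * r <= e * e by rewrite ler_pM2l.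
have : e ^+ 2 * q <= e ^+ 2 by rewrite ler_piMr// exprn_ge0// ltW.
rewrite expr2 in De H *; lra.
Qed.

Lemma gspan_integrable (m : {finite_measure set (Rn R n) -> \bar R}) f :
  gspan f -> m.-integrable setT (EFin \o f).
Proof.
move=> Hf; have [C C0 fC] := gspan_bounded _ Hf.
apply: measurable_bounded_integrable => //.
- by rewrite ltey_eq fin_num_measure.
- exact: gspan_measurable.
- exists C; split; first exact: num_real.
  by move=> M CM x _; exact: le_trans (fC x) (ltW CM).
Qed.

(** Induction on the construction of [f]. In the case of a uniform limit, unit mass makes the error
    of replacing [f] by [g_ k] at most 1 / (k + 1) for every measure, uniformly in [j], and three
    thirds of [e] suffice. *)
Lemma gspan_Rintegral_cvg f : gspan f ->
  (fun j => \int[lam_ j]_(x in setT) f x) @ \oo --> \int[lam]_(x in setT) f x.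
Proof.
elim=> {f} [t y t0|f g Hf cf Hg cg|c f Hf cf|g_ f Hg cg fg].
- exact: cvg_Rintegral_gauss.
- rewrite RintegralD//; [|exact: gspan_integrable..].
  rewrite (_ : (fun j => _) = (fun j => \int[lam_ j]_(x in setT) f x +
      \int[lam_ j]_(x in setT) g x)); last first.
    by apply/funext => j; rewrite RintegralD//; exact: gspan_integrable.
  exact: cvgD cf cg.
- rewrite RintegralZl//; [|exact: gspan_integrable..].
  rewrite (_ : (fun j => _) = (fun j => c * \int[lam_ j]_(x in setT) f x)); last first.
    by apply/funext => j; rewrite RintegralZl//; exact: gspan_integrable.
  exact: cvgM (cvg_cst _) cf.
- have Hf : gspan f by exact: gspan_cvg Hg fg.
  have close (m : {finite_measure set (Rn R n) -> \bar R}) k : m setT = 1%E ->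
      `|\int[m]_(x in setT) f x - \int[m]_(x in setT) g_ k x| <= k.+1%:R^-1.
    move=> m1; rewrite -RintegralB//; [|exact: gspan_integrable..].
    have Hfg : gspan (fun x => f x - g_ k x).
      by apply: gspan_ext (gspanD _ _ Hf (gspanZ (-1) _ (Hg k))) _ => x; rewrite mulN1r.
    apply: le_trans (le_normr_Rintegral _ _) _ => //; first exact: gspan_integrable.
    apply: (@le_trans _ _ (\int[m]_(x in setT) k.+1%:R^-1)).
      apply: le_Rintegral => //.
      + exact: gspan_integrable (gspan_abs _ Hfg).
      + exact: finite_measure_integrable_cst.
    by rewrite Rintegral_cst// [X in fine X]m1 mulr1.
  apply/cvgrPdist_le => e e0.
  have e3 : 0 < e / 3 by rewrite divr_gt0.
  have [k ke] := exists_invS_le (e / 3) e3.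
  move/cvgrPdist_le : (cg k) => /(_ _ e3); apply: filterS => j H.
  have := le_trans (close lam k lam1) ke.
  have := le_trans (close (lam_ j) k (lam1_ j)) ke.
  move: H; move: (Rintegral lam _ f) (Rintegral (lam_ j) _ f).
  move: (Rintegral lam _ (g_ k)) (Rintegral (lam_ j) _ (g_ k)) => b d a c.
  rewrite !ler_norml => /andP[h1 h2] /andP[h3 h4] /andP[h5 h6].
  apply/andP; split; lra.
Qed.

Lemma energy_cvg_vague : vague_cvg lam_ lam.
Proof.
move=> phi cphi Kphi; have Hphi := gspan_Cc phi cphi Kphi.
have E (m : {finite_measure set (Rn R n) -> \bar R}) :
    (\int[m]_x (phi x)%:E = (\int[m]_(x in setT) phi x)%:E)%E.
  by rewrite fineK//; apply: integrable_fin_num => //; exact: gspan_integrable.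
rewrite E; under eq_fun do rewrite E.
by apply/cvg_EFin; [exact: nearW|exact: gspan_Rintegral_cvg].
Qed.

End energy_convergence_is_vague.

(** * The Jordan decomposition of a difference, as an element of the energy space *)

Section difference_of_finite_measures.
Context {d} {T : measurableType d} {R : realType}.
Local Open Scope ereal_scope.
Implicit Types (mu nu p q tau : {finite_measure set T -> \bar R}).

(** Hahn decomposition of the charge [mu - nu]. The domination of [p] by [mu] and of [q] by [nu] is
    recorded because it transfers finiteness of the energies. *)
Lemma jordan_difference mu nu : exists (p q : {finite_measure set T -> \bar R}) (P : set T),
  [/\ measurable P, p (~` P) = 0 /\ q P = 0,
      forall A, measurable A -> p A + nu A = q A + mu A,
      forall A, measurable A -> p A <= mu A &
      forall A, measurable A -> q A <= nu A].
Proof.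
pose sigma : {charge set T -> \bar R} :=
  cadd (charge_of_finite_measure mu) (copp (charge_of_finite_measure nu)).
have sE A : sigma A = mu A - nu A by [].
have [P [N PN]] := Hahn_decomposition sigma.
have [[mP _] [mN _] PUN PIN] := PN.
have pE A : measurable A -> jordan_pos PN A = mu (A `&` P) - nu (A `&` P).
  by move=> mA; rewrite jordan_posE cjordan_posE /crestr0 mem_set.
have qE A : measurable A -> jordan_neg PN A = nu (A `&` N) - mu (A `&` N).
  move=> mA; rewrite jordan_negE cjordan_negE /crestr0 mem_set// /crestr sE.
  have mAN : measurable (A `&` N) by exact: measurableI.
  have : mu (A `&` N) \is a fin_num by exact: fin_num_measure.
  have : nu (A `&` N) \is a fin_num by exact: fin_num_measure.
  by move: (mu _) (nu _) => [x| |] [y| |]// _ _; rewrite -!EFinB -EFinN opprB.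
have p0 : jordan_pos PN (~` P) = 0.
  by rewrite pE ?setICl ?measure0 ?sube0//; exact: measurableC.
have q0 : jordan_neg PN P = 0 by rewrite qE// PIN !measure0 sube0.
have E A : measurable A -> jordan_pos PN A + nu A = jordan_neg PN A + mu A.
  move=> mA.
  have : mu A - nu A = jordan_pos PN A - jordan_neg PN A.
    by rewrite -sE (jordan_decomp PN mA) /cadd/= cscaleN1.
  have : jordan_pos PN A \is a fin_num by exact: fin_num_measure.
  have : jordan_neg PN A \is a fin_num by exact: fin_num_measure.
  have : mu A \is a fin_num by exact: fin_num_measure.
  have : nu A \is a fin_num by exact: fin_num_measure.
  move: (jordan_pos PN A) (jordan_neg PN A) (mu A) (nu A).
  move=> [x| |] [y| |] [z| |] [t| |]// _ _ _ _.
  by rewrite -!EFinB => -[H]; rewrite -!EFinD; congr EFin; lra.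
have pmu A : measurable A -> jordan_pos PN A <= mu A.
  move=> mA; rewrite pE//; apply: (@le_trans _ _ (mu (A `&` P))).
    by rewrite -[leRHS]adde0 leeD2l// oppe_le0; exact: measure_ge0.
  by rewrite le_measure// inE//; exact: measurableI.
have qnu A : measurable A -> jordan_neg PN A <= nu A.
  move=> mA; rewrite qE//; apply: (@le_trans _ _ (nu (A `&` N))).
    by rewrite -[leRHS]adde0 leeD2l// oppe_le0; exact: measure_ge0.
  by rewrite le_measure// inE//; exact: measurableI.
by exists (jordan_pos PN), (jordan_neg PN), P.
Qed.

Variable k : T * T -> \bar R.
Hypotheses (mk : measurable_fun setT k) (k0 : forall z, 0 <= k z)
  (ksym : forall x y, k (x, y) = k (y, x)) (pk : pos_def k).

Lemma kenergy_le_measure (m1 m2 n1 n2 : {finite_measure set T -> \bar R}) :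
  (forall A, measurable A -> m1 A <= m2 A) ->
  (forall A, measurable A -> n1 A <= n2 A) ->
  kenergy k m1 n1 <= kenergy k m2 n2.
Proof.
move=> m12 n12; apply: (@le_trans _ _ (kenergy k m2 n1)).
  apply: ge0_le_measure_integral => //; first by move=> x; apply: integral_ge0.
  exact: measurable_kpotential.
apply: ge0_le_integral => //.
- by move=> x _; exact: integral_ge0.
- exact: measurable_kpotential.
- exact: measurable_kpotential.
move=> x _; apply: ge0_le_measure_integral => //; exact: measurable_ksection.
Qed.

Lemma kenergy_difference mu nu p q tau :
  (forall A, measurable A -> p A + nu A = q A + mu A) ->
  kenergy k p tau < +oo -> kenergy k q tau < +oo ->
  kenergy k mu tau < +oo -> kenergy k nu tau < +oo ->
  (real_energy k p tau + real_energy k nu tau = real_energy k q tau + real_energy k mu tau)%R.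
Proof.
move=> H ip iq im iN.
pose one : {nonneg R} := NngNum (@ler01 R).
have : kenergy k (fcomb one one p nu) tau = kenergy k (fcomb one one q mu) tau.
  apply: eq_measure_integral => A mA _.
  by rewrite /fcomb/= !mcombE/= !mul1e; exact: H.
rewrite !kenergy_fcombl// /one/= !mul1e.
rewrite (kenergyE _ k0 _ _ ip) (kenergyE _ k0 _ _ iN) (kenergyE _ k0 _ _ iq).
by rewrite (kenergyE _ k0 _ _ im) -!EFinD => -[].
Qed.

(** Pairing the identity p + nu = q + mu with each of [p], [q], [mu] and [nu] gives four linear
    relations between finite energies, and these imply the equality. *)
Lemma energy_dist2_difference mu nu p q :
  (forall A, measurable A -> p A + nu A = q A + mu A) ->
  kenergy k p p < +oo -> kenergy k q q < +oo ->
  kenergy k mu mu < +oo -> kenergy k nu nu < +oo ->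
  energy_dist2 k p q = energy_dist2 k mu nu.
Proof.
move=> H ip iq im iN.
have X (a b : {finite_measure set T -> \bar R}) (ha : kenergy k a a < +oo) (hb : kenergy k b b < +oo) : kenergy k a b < +oo.
  exact: (kenergy_cross_lty _ k0 pk _ _ ha hb).
have D (tau : {finite_measure set T -> \bar R}) (ht : kenergy k tau tau < +oo) :=
  kenergy_difference mu nu p q tau H (X _ _ ip ht) (X _ _ iq ht) (X _ _ im ht) (X _ _ iN ht).
have C := real_energyC k mk k0 ksym.
have := D _ ip; have := D _ iq; have := D _ im; have := D _ iN.
rewrite /energy_dist2 (C q p) (C nu p) (C mu p) (C nu q) (C mu q) (C nu mu).
move: (real_energy k p p) (real_energy k q q) (real_energy k mu mu) (real_energy k nu nu).
move: (real_energy k p q) (real_energy k p mu) (real_energy k p nu).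
move: (real_energy k q mu) (real_energy k q nu) (real_energy k mu nu).
clear => *; lra.
Qed.

End difference_of_finite_measures.

Section jordan_signed_radon.
Context {R : realType} {n : nat} (alpha : R).
Hypothesis alphan : alpha < n%:R.
Implicit Types (mu nu : {finite_measure set (Rn R n) -> \bar R}).
Local Open Scope ereal_scope.

Lemma measurable_enorm : measurable_fun setT (fun x : Rn R n => enorm x).
Proof.
apply: (measurableT_comp (continuous_measurable_fun (@sqrt_continuous R))).
apply: measurable_sum => i; apply: measurable_funX; exact: measurable_coord.
Qed.

Lemma closed_measurable_Rn (F : set 'rV[R]_n) : closed F -> measurable (F : set (Rn R n)).
Proof.
move=> cF; rewrite -(setCK F); apply: measurableC.
by apply: sub_sigma_algebra; exact: closed_openC.
Qed.

(** Outside the unit ball the weight is at most 1, the exponent alpha - n being negative, so its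
    integral is bounded by the total mass. *)
Lemma finite_Mpos mu : Mpos alpha mu.
Proof.
split=> [K Kc|].
  apply: (@le_lt_trans _ _ (mu setT)).
    rewrite le_measure// inE//; apply: closed_measurable_Rn.
    by apply: compact_closed => //; exact: norm_hausdorff.
  by rewrite ltey_eq fin_num_measure.
have mD : measurable [set y : Rn R n | (1 < enorm y)%R].
  have := measurable_enorm measurableT _ (measurable_itv `]1%R, +oo[).
  rewrite setTI; congr measurable.
  by apply/seteqP; split=> y /=; rewrite in_itv/= andbT.
apply: (@le_lt_trans _ _ (\int[mu]_(y in [set y : Rn R n | (1 < enorm y)%R]) 1)).
  apply: ge0_le_integral => //.
  - by move=> y _; rewrite lee_fin powR_ge0.
  - apply: measurable_funTS; apply/measurable_EFinP.
    by apply: (measurableT_comp (measurable_powR _)); exact: measurable_enorm.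
  move=> y /= y1; rewrite lee_fin -[leRHS](powRr0 (enorm y)).
  by apply: ler_powR; [exact: ltW|rewrite subr_le0 ltW].
by rewrite integral_cst// mul1e ltey_eq fin_num_measure.
Qed.

(** Supplies the witnesses required by [strong_cvg], with a norm expressed through the positive
    measures only. *)
Lemma jordan_signed_radon mu nu :
  energy alpha mu mu < +oo -> energy alpha nu nu < +oo ->
  exists s : @signed_radon R n alpha,
    [/\ finite_energy s, is_difference mu nu s &
        snorm s = Num.sqrt (energy_dist2 (rieszk alpha) mu nu)].
Proof.
rewrite !energyE => im iN.
have mr := measurable_rieszk alpha alphan (n := n).
have r0 := rieszk_ge0 (n := n) alpha.
have rs := rieszk_sym (n := n) alpha.
have pr := pos_def_rieszk alpha alphan (n := n).
have [p [q [P [mP [pP qP] E pm qn]]]] := jordan_difference mu nu.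
have ip : kenergy (rieszk alpha) p p < +oo.
  by apply: le_lt_trans im; exact: kenergy_le_measure.
have iq : kenergy (rieszk alpha) q q < +oo.
  by apply: le_lt_trans iN; exact: kenergy_le_measure.
have ipq := kenergy_cross_lty _ r0 pr _ _ ip iq.
have iqp := kenergy_cross_lty _ r0 pr _ _ iq ip.
have S : exists2 P : set (Rn R n), measurable P & p (~` P) = 0 /\ q P = 0 by exists P.
exists (SignedRadon (finite_Mpos p) (finite_Mpos q) S); split.
- rewrite /finite_energy energyE /abs_radon/=.
  pose one : {nonneg R} := NngNum (@ler01 R).
  have -> : kenergy (rieszk alpha) (measure_add p q) (measure_add p q) =
      kenergy (rieszk alpha) (fcomb one one p q) (fcomb one one p q).
    have mE A : measurable A -> measure_add p q A = fcomb one one p q A.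
      by move=> mA; rewrite measure_addE /fcomb/= mcombE/= !mul1e.
    rewrite /kenergy; under eq_integral => x _.
      rewrite (eq_measure_integral (fcomb one one p q)); last by move=> A mA _; exact: mE.
      over.
    by apply: eq_measure_integral => A mA _; exact: mE.
  rewrite !(kenergy_fcombl, kenergy_fcombr)//= !mul1e.
  by apply: lte_add_pinfty; apply: lte_add_pinfty.
- by move=> B mB; exact: E.
- rewrite /snorm; congr (Num.sqrt _).
  rewrite -(energy_dist2_difference _ mr r0 rs pr mu nu p q E ip iq im iN).
  rewrite /senergy/= !energyE (kenergyE _ r0 _ _ ip) (kenergyE _ r0 _ _ iq).
  rewrite (kenergyE _ r0 _ _ ipq) (kenergyE _ r0 _ _ iqp) /=.
  by rewrite /energy_dist2 (real_energyC _ mr r0 rs q p); ring.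
Qed.

End jordan_signed_radon.

(** * Restrictions of measures and exhaustion by increasing sets *)

Section restricted_measure.
Context {d} {T : measurableType d} {R : realType}.
Local Open Scope ereal_scope.
Variables (mu : {finite_measure set T -> \bar R}) (B : set T) (mB : measurable B).

Lemma ge0_integral_mrestr (D : set T) (f : T -> \bar R) :
  measurable D -> measurable_fun D f -> (forall x, D x -> 0 <= f x) ->
  \int[mrestr mu mB]_(x in D) f x = \int[mu]_(x in D `&` B) f x.
Proof.
move=> mD mf f0.
rewrite (@ge0_negligible_integral _ _ _ (mrestr mu mB) D (~` B))//; last 2 first.
- exact: measurableC.
- by rewrite /= /mrestr setICl measure0.
rewrite setDE setCK; apply: eq_measure_integral => A mA ADB.
by rewrite /= /mrestr setIidl// => x /ADB[].
Qed.

Lemma integrable_mrestr (D : set T) (f : T -> \bar R) :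
  measurable D -> mu.-integrable D f -> (mrestr mu mB).-integrable D f.
Proof.
move=> mD /integrableP[mf imu]; apply/integrableP; split => //.
rewrite ge0_integral_mrestr//; last exact: measurableT_comp.
apply: le_lt_trans imu; apply: ge0_subset_integral => //.
- exact: measurableI.
- exact: measurableT_comp.
Qed.

Lemma integral_mrestr (D : set T) (f : T -> \bar R) :
  measurable D -> mu.-integrable D f ->
  \int[mrestr mu mB]_(x in D) f x = \int[mu]_(x in D `&` B) f x.
Proof.
move=> mD imu; have mf := measurable_int _ imu.
rewrite integralE [RHS]integralE !ge0_integral_mrestr//.
- exact: measurable_funeneg.
- exact: measurable_funepos.
Qed.

End restricted_measure.

Section restricted_integrals_converge.
Context {d} {T : measurableType d} {R : realType}.
Local Open Scope ereal_scope.
Variables (mu : {measure set T -> \bar R}) (B : nat -> set T) (D : set T).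
Hypotheses (mB : forall j, measurable (B j)) (ndB : nondecreasing_seq B)
  (mD : measurable D) (muB : mu (~` \bigcup_j B j) = 0).

(** Monotone convergence for the positive and the negative part separately; integrability makes the
    difference of the two limits meaningful. *)
Lemma cvg_integral_restricted (f : T -> \bar R) : mu.-integrable D f ->
  (fun j => \int[mu]_(x in D `&` B j) f x) @ \oo --> \int[mu]_(x in D) f x.
Proof.
move=> imu; have mf := measurable_int _ imu.
have mU : measurable (\bigcup_j B j) by exact: bigcup_measurable.
rewrite (negligible_integral (measurableC mU) mD imu muB) setDE setCK.
have DU : \bigcup_j (D `&` B j) = D `&` \bigcup_j B j by rewrite setI_bigcupr.
have sub j : D `&` B j `<=` D by exact: subIsetl.
have mDB j : measurable (D `&` B j) by exact: measurableI.
have pos (g : T -> \bar R) : measurable_fun D g -> (forall x, 0 <= g x) ->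
    (fun j => \int[mu]_(x in D `&` B j) g x) @ \oo -->
    \int[mu]_(x in D `&` \bigcup_j B j) g x.
  move=> mg g0; rewrite -DU; apply: ge0_nondecreasing_set_cvg_integral => //.
  - by move=> i j ij; apply/subsetPset; apply: setIS; apply/subsetPset; exact: ndB.
  - by move=> i; exact: measurable_funS mg.
rewrite integralE; under eq_fun do rewrite integralE.
have iD : mu.-integrable (D `&` \bigcup_j B j) f.
  by apply: integrableS imu => //; exact: measurableI.
apply: cvgeB.
- apply: fin_num_adde_defl.
  by rewrite fin_numN; apply: integrable_neg_fin_num => //; exact: measurableI.
- by apply: pos => //; exact: measurable_funepos.
- by apply: pos => //; exact: measurable_funeneg.
Qed.

End restricted_integrals_converge.

Section finite_measure_of_measure.
Context {d} {T : measurableType d} {R : realType}.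
Variable mu : {measure set T -> \bar R}.

Definition finite_of & fin_num_fun mu : set T -> \bar R := mu.

HB.instance Definition _ h := Measure.on (finite_of h).

HB.instance Definition _ h := Measure_isFinite.Build _ _ _ (finite_of h) h.

(** An equality of measures, so that an arbitrary Borel measure of finite mass can be replaced by
    rewriting with one to which the energy lemmas apply. *)
Lemma finite_measure_of : (mu setT < +oo)%E ->
  exists m : {finite_measure set T -> \bar R}, (m : {measure set T -> \bar R}) = mu.
Proof.
move=> muT.
have fin : fin_num_fun mu by exact: lty_fin_num_fun.
by exists (finite_of fin); exact: eq_measure.
Qed.

End finite_measure_of_measure.

(** * Minimal energies along an increasing union *)

Section energy_infimum_over_increasing_sets.
Context {R : realType} {n : nat} (alpha : R).
Hypothesis alphan : (alpha < n%:R)%R.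
Local Open Scope ereal_scope.
Variables (F : set 'rV[R]_n) (f : 'rV[R]_n -> \bar R).
Hypothesis mF : measurable (F : set (Rn R n)).
Implicit Types (A Q B : set 'rV[R]_n).

Lemma wf_subset Q1 Q2 : Q1 `<=` Q2 -> wf alpha F f Q2 <= wf alpha F f Q1.
Proof.
move=> Q12; apply: ereal_inf_le_tmp => _ [mu [[[Mmu nQ imu] mu1] fmu] <-].
exists mu => //; split=> //; split=> //; split=> //.
by apply: negligibleS nQ; exact: subsetC.
Qed.

(** The competitor is [mu] restricted to [B] and normalized. Its energy is only estimated, by that
    of the whole of [mu], which the positive kernel permits; the field may change sign, so its
    integral is computed exactly. *)
Lemma wf_le_restricted (mu : {finite_measure set (Rn R n) -> \bar R}) Q B :
  measurable (B : set (Rn R n)) -> B `<=` Q -> energy alpha mu mu < +oo ->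
  mu.-integrable F f -> 0 < mu B ->
  wf alpha F f Q <= (((fine (mu B))^-1) ^+ 2 * fine (energy alpha mu mu) +
    2 * ((fine (mu B))^-1 * fine (\int[mu]_(x in F `&` B) f x)))%:E.
Proof.
move=> mB BQ imu fmu B0.
have mr := measurable_rieszk alpha alphan (n := n).
have r0 := rieszk_ge0 (n := n) alpha.
have rs := rieszk_sym (n := n) alpha.
have Bfin : mu B \is a fin_num by exact: fin_num_measure.
have m0 : (0 < fine (mu B))%R by rewrite fine_gt0// B0 ltey_eq Bfin.
have c0 : (0 <= (fine (mu B))^-1)%R by rewrite invr_ge0 ltW.
pose c : {nonneg R} := NngNum c0.
(* A zero coefficient turns [fcomb] into a mere scaling, so that the lemmas on combinations apply to
   the normalized restriction. *)
pose z : {nonneg R} := NngNum (lexx (0%R : R)).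
pose nu : {finite_measure set (Rn R n) -> \bar R} :=
  fcomb c z (mrestr mu mB) mu.
have nuE A : nu A = c%:num%:E * mu (A `&` B).
  by rewrite /nu /fcomb/= mcombE/= mul0e adde0.
have nu1 : nu setT = 1.
  by rewrite nuE setTI -(fineK Bfin) -EFinM mulVf// gt_eqF.
have fr : (mrestr mu mB).-integrable F f by exact: integrable_mrestr.
have fnu : nu.-integrable F f by exact: integrable_mcomb.
have Ifnu : \int[nu]_(x in F) f x = c%:num%:E * \int[mu]_(x in F `&` B) f x.
  by rewrite [LHS]integral_mcomb//= mul0e adde0 integral_mrestr.
have inu : energy alpha nu nu <= (c%:num ^+ 2)%:E * energy alpha mu mu.
  rewrite !energyE.
  apply: (@le_trans _ _ (kenergy (rieszk alpha) (fcomb c z mu mu) (fcomb c z mu mu))).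
    have nule (A : set (Rn R n)) : measurable A -> nu A <= fcomb c z mu mu A.
      move=> mA; rewrite nuE /fcomb/= mcombE/= mul0e adde0.
      apply: lee_wpmul2l; first by rewrite lee_fin.
      apply: le_measure; rewrite ?inE//; first exact: (measurableI _ _ mA mB).
    exact: kenergy_le_measure.
  by rewrite !(kenergy_fcombl, kenergy_fcombr)//= !mul0e !adde0 muleA -EFinM.
have ifin : energy alpha mu mu \is a fin_num.
  exact: (kenergy_fin_num _ r0 _ _ imu).
have inu_lty : energy alpha nu nu < +oo.
  by apply: le_lt_trans inu _; rewrite -(fineK ifin) -EFinM ltry.
apply: (@le_trans _ _ (fenergy alpha F f nu)).
  apply: ereal_inf_lbound; exists nu => //; split=> //; split=> //; split=> //.
    exact: finite_Mpos.
  exists (~` B); split; first exact: measurableC.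
    by have := nuE (~` B); rewrite setICl measure0 mule0.
  exact: subsetC.
have hfin : \int[mu]_(x in F `&` B) f x \is a fin_num.
  apply: integral_fune_fin_num; first exact: measurableI.
  by apply: integrableS fmu => //; exact: measurableI.
rewrite /fenergy Ifnu -{1}(fineK hfin) -!EFinM EFinD leeD2r//.
by apply: le_trans inu _; rewrite -{1}(fineK ifin) -EFinM.
Qed.

Lemma wf_bigcup_cvg (A_ : nat -> set 'rV[R]_n) A :
  (forall j, A_ j `<=` A_ j.+1) -> (forall j, univ_measurable (A_ j)) ->
  A = \bigcup_j A_ j ->
  (fun j => wf alpha F f (A_ j)) @ \oo --> wf alpha F f A.
Proof.
move=> incr um AE.
have mono i j : (i <= j)%N -> A_ i `<=` A_ j.
  move/subnKC <-; elim: (j - i)%N => [|k IH]; first by rewrite addn0.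
  by rewrite addnS; apply: subset_trans IH _.
have sub j : A_ j `<=` A by rewrite AE; exact: bigcup_sup.
suff -> : wf alpha F f A = ereal_inf (range (fun j => wf alpha F f (A_ j))).
  by apply: ereal_nonincreasing_cvgn => i j ij; apply: wf_subset; exact: mono.
apply/eqP; rewrite eq_le; apply/andP; split.
  by apply: le_ereal_inf_tmp => _ [j _ <-]; exact: wf_subset.
apply: le_ereal_inf_tmp => _ [mu0 [[[Mmu nA imu] mu1] fmu] <-].
have [mu muE] := finite_measure_of mu0 ltac:(by rewrite mu1 ltry).
rewrite -{}muE in Mmu nA imu mu1 fmu *.
(* Universal measurability, applied to the competitor itself, yields a Borel subset of each [A_ j]
   of full [mu]-measure in it. These need not increase; the finite unions [B] do, and stay inside
   [A_ j] by monotonicity. *)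
have /choice[C HC] : forall j, exists C : set (Rn R n),
    [/\ measurable C, C `<=` A_ j & mu.-negligible (A_ j `\` C)].
  move=> j; have [C mC [N nN CN]] := um j mu (proj1 Mmu).
  exists C; split => //; first by rewrite -CN; exact: subsetUl.
  by apply: negligibleS nN => x; rewrite -CN => -[[]].
pose B (j : nat) : set (Rn R n) := \bigcup_(i in `I_j.+1) C i.
have mB j : measurable (B j).
  by apply: bigcup_measurable => i _; case: (HC i).
have BA j : B j `<=` A_ j.
  by move=> x [i /= ij Cx]; apply: (mono i j); [rewrite -ltnS|case: (HC i) => _ + _; exact].
have ndB : nondecreasing_seq B.
  move=> i j ij; apply/subsetPset; apply: bigcup_subset => k /= ki.
  exact: leq_trans ki _.
have mU : measurable (\bigcup_j B j) by exact: bigcup_measurable.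
have muB : mu (~` \bigcup_j B j) = 0.
  apply/measure_negligible; first exact: measurableC.
  have NE : ~` (\bigcup_j B j) `<=` ~` A `|` \bigcup_j (A_ j `\` C j).
    move=> x nB; have [Ax|] := pselect (A x); last by left.
    right; move: Ax; rewrite AE => -[j _ Ax]; exists j => //; split=> // Cx.
    by apply: nB; exists j => //; exists j => //=.
  apply: (negligibleS NE).
  by apply: negligibleU => //; apply: negligible_bigcup => j; case: (HC j).
have cmB : mu (B j) @[j --> \oo] --> (1 : \bar R).
  have -> : 1 = mu (\bigcup_j B j).
    have mUC := measurableC mU.
    rewrite -mu1 -(setUv (\bigcup_j B j)) measureU ?setICr//.
    by rewrite [X in _ + X]muB adde0.
  exact: nondecreasing_cvg_mu.
pose m j := fine (mu (B j)).
pose h j := fine (\int[mu]_(x in F `&` B j) f x).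
have cm : m @ \oo --> (1%R : R) by exact: fine_cvg.
have ffin : \int[mu]_(x in F) f x \is a fin_num by exact: integral_fune_fin_num.
have ch : h @ \oo --> fine (\int[mu]_(x in F) f x).
  apply: fine_cvg; rewrite fineK//.
  exact: cvg_integral_restricted.
have ifin : energy alpha mu mu \is a fin_num.
  exact: (kenergy_fin_num _ (rieszk_ge0 alpha) _ _ imu).
have cmV : (fun j => (m j)^-1)%R @ \oo --> (1%R : R).
  by rewrite -[X in _ --> X]invr1; apply: cvgV => //; exact: oner_neq0.
have cv : (fun j => (m j)^-1 ^+ 2 * fine (energy alpha mu mu) + 2 * ((m j)^-1 * h j))%R @ \oo -->
    (fine (energy alpha mu mu) + 2 * fine (\int[mu]_(x in F) f x))%R.
  have := cvgD (cvgM (cvgM cmV cmV) (cvg_cst (fine (energy alpha mu mu))))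
    (cvgM (cvg_cst (2%R : R)) (cvgM cmV ch)).
  by rewrite !mul1r; exact.
have -> : fenergy alpha F f mu =
    (fine (energy alpha mu mu) + 2 * fine (\int[mu]_(x in F) f x))%:E.
  by rewrite EFinD EFinM !fineK.
have cve : (fun j => ((m j)^-1 ^+ 2 * fine (energy alpha mu mu) + 2 * ((m j)^-1 * h j))%:E)
    @ \oo --> (fine (energy alpha mu mu) + 2 * fine (\int[mu]_(x in F) f x))%:E.
  by apply: cvg_EFin; [exact: nearW|exact: cv].
apply: (cvge_to_ge cve).
(* Normalizing requires [mu (B j) > 0]. The masses tend to 1, so at precision 1 they are eventually
   positive. *)
move/cvgrPdist_lt : cm => /(_ 1%R ltr01); apply: filterS => j /=.
rewrite ltr_distlC => /andP[mj _].
apply: le_trans (wf_le_restricted mu (A_ j) (B j) _ _ _ _ _) => //.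
  by apply: ereal_inf_lbound; exists j.
by rewrite -(fineK (fin_num_measure mu _ (mB j))) lte_fin; move: mj; rewrite subrr.
Qed.

End energy_infimum_over_increasing_sets.

(** * Convexity of the Gauss functional and its minimizers *)

Section minimizers.
Context {R : realType} {n : nat} (alpha : R).
Hypothesis alphan : (alpha < n%:R)%R.
Variables (F : set 'rV[R]_n) (f : 'rV[R]_n -> \bar R) (A : set 'rV[R]_n).
Hypotheses (mF : measurable (F : set (Rn R n))) (AF : A `<=` F).
Implicit Types (mu lam : {finite_measure set (Rn R n) -> \bar R}).
Local Open Scope ereal_scope.

Let r0 := rieszk_ge0 (n := n) alpha.
Let mr := measurable_rieszk alpha alphan (n := n).
Let rs := rieszk_sym (n := n) alpha.
Let pr := pos_def_rieszk alpha alphan (n := n).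

Definition fieldint mu : R := fine (\int[mu]_(x in F) f x).

Lemma fenergyE mu : Epos1f alpha F f A mu ->
  fenergy alpha F f mu = (real_energy (rieszk alpha) mu mu + 2 * fieldint mu)%:E.
Proof.
move=> [[[_ _ imu] _] fmu].
have hfin : \int[mu]_(x in F) f x \is a fin_num by exact: integral_fune_fin_num.
by rewrite /fenergy energyE (kenergyE _ r0 _ _ imu) -(fineK hfin) -EFinM -EFinD.
Qed.

(** A measure concentrated on [A] does not charge the complement of [F], so the potential integrates
    over [F] to the full energy; it is therefore integrable and the integral of the sum splits. *)
Lemma cfE mu : Epos1f alpha F f A mu ->
  cf alpha F f mu = (real_energy (rieszk alpha) mu mu + fieldint mu)%:E.
Proof.
move=> [[[_ nmu imu] _] fmu].
have hfin : \int[mu]_(x in F) f x \is a fin_num by exact: integral_fune_fin_num.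
have mpot : measurable_fun setT (potential alpha mu : Rn R n -> \bar R).
  exact: (measurable_kpotential (rieszk alpha) mr r0 mu).
have pot0 x : 0 <= potential alpha mu x.
  by apply: integral_ge0 => y _; exact: (r0 (x, y)).
have muF : mu (~` F) = 0.
  apply/measure_negligible; first exact: measurableC.
  by apply: negligibleS nmu; exact: subsetC.
have potE : \int[mu]_(x in F) potential alpha mu x = energy alpha mu mu.
  rewrite /energy (ge0_negligible_integral (measurableC mF) measurableT mpot _ muF)//.
  by rewrite setTD setCK.
have ipot : mu.-integrable F (potential alpha mu).
  apply/integrableP; split; first exact: measurable_funTS.
  under eq_integral => x _ do rewrite gee0_abs//.
  by rewrite potE.
rewrite /cf integralD// potE energyE (kenergyE _ r0 _ _ imu) -(fineK hfin).
by rewrite -EFinD.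
Qed.

(** The midpoint [sigma] of [mu] and [lam] is a competitor, and I_f(sigma) is the mean of I_f(mu)
    and I_f(lam) minus a quarter of the squared distance. Comparing with I_f(lam) <= I_f(sigma)
    gives the bound. *)
Lemma minimizer_dist2_le mu lam : is_minimizer alpha F f A lam ->
  Epos1f alpha F f A mu ->
  (energy_dist2 (rieszk alpha) mu lam <=
   2 * ((real_energy (rieszk alpha) mu mu + 2 * fieldint mu) -
        (real_energy (rieszk alpha) lam lam + 2 * fieldint lam)))%R.
Proof.
move=> [Elam wlam] Emu.
have [[[_ nmu imu] mu1] fmu] := Emu.
have [[[_ nlam ilam] lam1] flam] := Elam.
rewrite !energyE in imu ilam.
have iml := kenergy_cross_lty _ r0 pr _ _ imu ilam.
have h0 : (0 <= 2^-1 :> R)%R by rewrite invr_ge0.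
pose h : {nonneg R} := NngNum h0.
pose sigma : {finite_measure set (Rn R n) -> \bar R} := fcomb h h mu lam.
have sE B : sigma B = (2^-1)%:E * mu B + (2^-1)%:E * lam B.
  by rewrite /sigma /fcomb/= mcombE.
have isigma : kenergy (rieszk alpha) sigma sigma =
    (2^-1 * (2^-1 * real_energy (rieszk alpha) mu mu + 2^-1 * real_energy (rieszk alpha) mu lam) +
     2^-1 * (2^-1 * real_energy (rieszk alpha) mu lam + 2^-1 * real_energy (rieszk alpha) lam lam))%:E.
  rewrite /sigma !(kenergy_fcombl, kenergy_fcombr)//.
  rewrite (kenergyC _ lam mu mr r0 rs) (kenergyE _ r0 _ _ imu) (kenergyE _ r0 _ _ iml).
  by rewrite (kenergyE _ r0 _ _ ilam).
have fsigma : sigma.-integrable F f by exact: integrable_mcomb.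
have hmu : \int[mu]_(x in F) f x \is a fin_num by exact: integral_fune_fin_num.
have hlam : \int[lam]_(x in F) f x \is a fin_num by exact: integral_fune_fin_num.
have fisigma : fieldint sigma = (2^-1 * fieldint mu + 2^-1 * fieldint lam)%R.
  rewrite /fieldint (_ : \int[sigma]_(x in F) f x = (2^-1)%:E * \int[mu]_(x in F) f x +
    (2^-1)%:E * \int[lam]_(x in F) f x); last exact: integral_mcomb.
  by rewrite -{1}(fineK hmu) -{1}(fineK hlam).
have Esigma : Epos1f alpha F f A sigma.
  split=> //; split; first split.
  - exact: finite_Mpos.
  - have [N [mN muN NA]] := nmu; have [M [mM lamM MA]] := nlam.
    exists (N `&` M); split; [exact: measurableI| |by move=> x nA; split; [exact: NA|exact: MA]].
    have mNM : measurable (N `&` M) by exact: measurableI.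
    have muNM : mu (N `&` M) = 0.
      by apply: (subset_measure0 mNM mN) => //; exact: subIsetl.
    have lamNM : lam (N `&` M) = 0.
      by apply: (subset_measure0 mNM mM) => //; exact: subIsetr.
    by rewrite [LHS]sE muNM lamNM !mule0 adde0.
  - by rewrite energyE isigma ltry.
  - rewrite [LHS]sE [X in _ * X + _]mu1 [X in _ + _ * X]lam1 !mule1 -EFinD.
    by congr EFin; field.
have : fenergy alpha F f lam <= fenergy alpha F f sigma.
  by rewrite wlam; apply: ereal_inf_lbound; exists sigma.
rewrite (fenergyE lam Elam) (fenergyE sigma Esigma) lee_fin fisigma.
have -> : real_energy (rieszk alpha) sigma sigma =
    (2^-1 * (2^-1 * real_energy (rieszk alpha) mu mu + 2^-1 * real_energy (rieszk alpha) mu lam) +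
     2^-1 * (2^-1 * real_energy (rieszk alpha) mu lam + 2^-1 * real_energy (rieszk alpha) lam lam))%R.
  by rewrite /real_energy isigma.
rewrite /energy_dist2.
move: (real_energy _ mu mu) (real_energy _ mu lam) (real_energy _ lam lam) (fieldint mu) (fieldint lam).
by move=> x1 x2 x3 x4 x5 H; lra.
Qed.

End minimizers.

(** * Continuity of the energy under strong convergence *)

Section energy_continuity.
Context {R : realType} {n : nat} (alpha : R).
Hypothesis alphan : alpha < n%:R.
Variables (lam_ : nat -> {finite_measure set (Rn R n) -> \bar R})
  (lam : {finite_measure set (Rn R n) -> \bar R}).
Hypotheses (ilam_ : forall j, (kenergy (rieszk alpha) (lam_ j) (lam_ j) < +oo)%E)
  (ilam : (kenergy (rieszk alpha) lam lam < +oo)%E)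
  (dlam : (fun j => energy_dist2 (rieszk alpha) (lam_ j) lam) @ \oo --> (0 : R)).

Lemma real_energy_cvg : (fun j => real_energy (rieszk alpha) (lam_ j) (lam_ j)) @ \oo -->
  real_energy (rieszk alpha) lam lam.
Proof.
set I := real_energy _ lam lam.
have I0 : 0 <= I by apply/fine_ge0/kenergy_ge0; exact: rieszk_ge0.
have cross : (fun j => real_energy (rieszk alpha) (lam_ j) lam) @ \oo --> I.
  apply/cvgrPdist_le => e e0.
  (* Cauchy-Schwarz with [tau = lam]: if the squared distance is at most [c * e], then 2 c r <= c e
     + c^2 I <= 2 c e, because c I <= e. Adding 1 avoids division by zero when [I] vanishes. *)
  pose c := e / (I + 1).
  have c0 : 0 < c by rewrite divr_gt0// ltr_wpDl.
  have cI : c * (I + 1) = e by rewrite divfK// gt_eqF// ltr_wpDl.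
  move/cvgrPdist_le : dlam => /(_ _ (mulr_gt0 c0 e0)); apply: filterS => j.
  rewrite sub0r normrN => H; rewrite distrC.
  have := energy_dist2_bound (rieszk alpha) (measurable_rieszk alpha alphan)
    (rieszk_ge0 alpha) (rieszk_sym alpha) (pos_def_rieszk alpha alphan)
    (lam_ j) lam lam c (ltW c0) (ilam_ j) ilam ilam.
  move: H; rewrite -/I; move: (energy_dist2 _ _ _) (real_energy _ (lam_ j) lam) => D g H.
  have {}H := le_trans (ler_norm D) H.
  set r := `|g - I| => Hr.
  suff : c * r <= c * e by rewrite ler_pM2l.
  have cc : c * (c * I) <= c * e.
    by rewrite ler_pM2l// -cI ler_pM2l// lerDl.
  rewrite expr2 -mulrA in Hr; lra.
have -> : (fun j => real_energy (rieszk alpha) (lam_ j) (lam_ j)) =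
    (fun j => energy_dist2 (rieszk alpha) (lam_ j) lam +
      2 * real_energy (rieszk alpha) (lam_ j) lam - I).
  by apply/funext => j; rewrite /energy_dist2 -/I; ring.
have {2}-> : I = 0 + 2 * I - I by ring.
exact: cvgB (cvgD dlam (cvgM (cvg_cst (2 : R)) cross)) (cvg_cst I).
Qed.

End energy_continuity.

Theorem theorem2p4 (R : realType) (n : nat) (alpha : R)
  (hn : (2 <= n)%N) (halpha : 0 < alpha < n%:R)
  (A_ : nat -> set 'rV[R]_n)
  (A_incr : forall j, A_ j `<=` A_ j.+1)
  (A_meas : forall j, univ_measurable (A_ j))
  (A : set 'rV[R]_n) (A_def : A = \bigcup_j A_ j)
  (psi : 'rV[R]_n -> \bar R) (theta omega : @signed_radon R n alpha)
  (hpsi : Phi (closure A) psi)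
  (htheta : finite_energy theta)
  (homega : bounded_radon omega)
  (hdist : (0 < ereal_inf
     [set (enorm (x - y))%:E | x in supp omega & y in A])%E)
  (hcap : (0 < inner_capacity alpha [set x | A x /\ (psi x < +oo)%E])%E)
  (F : set 'rV[R]_n) (F_def : F = closure A)
  (f : 'rV[R]_n -> \bar R) (f_def : f = field psi theta omega) :
  ((forall j, (wf alpha F f (A_ j.+1) <= wf alpha F f (A_ j))%E) /\
   (fun j => wf alpha F f (A_ j)) @ \oo --> wf alpha F f A) /\
  (forall (lam : bmeasure R n) (lam_ : nat -> bmeasure R n),
     is_minimizer alpha F f A lam ->
     (forall j, is_minimizer alpha F f (A_ j) (lam_ j)) ->
     [/\ strong_cvg alpha lam_ lam,
         vague_cvg lam_ lam
       & (fun j => cf alpha F f (lam_ j)) @ \oo --> cf alpha F f lam]).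

Proof.
have alphan : alpha < n%:R by case/andP: halpha.
have mF : measurable (F : set (Rn R n)).
  by apply: closed_measurable_Rn; rewrite F_def; exact: closed_closure.
have AF : A `<=` F by rewrite F_def; exact: subset_closure.
have sub j : A_ j `<=` A by rewrite A_def; exact: bigcup_sup.
have wcvg := wf_bigcup_cvg alpha alphan F f mF A_ A A_incr A_meas A_def.
split; first by split=> [j|//]; exact: wf_subset.
move=> lam0 lam0_ minlam0 minlam0_.
have [lam lamE] := finite_measure_of lam0
  ltac:(by have [[[_ ->] _] _] := minlam0; exact: ltry).
have /choice[lam_ lam_E] : forall j, exists m : {finite_measure set (Rn R n) -> \bar R},
    (m : bmeasure R n) = lam0_ j.
  move=> j; apply: finite_measure_of.
  by have [[[_ ->] _] _] := minlam0_ j; exact: ltry.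
have {lam_E} lam_E : lam0_ = (fun j => lam_ j : bmeasure R n) by apply/funext => j.
subst lam0 lam0_.
have Elam : Epos1f alpha F f A lam by case: minlam0.
(* Each [lam_ j] is also a competitor for the larger set [A], so the convexity bound around [lam]
   applies to it. *)
have Elam_ j : Epos1f alpha F f A (lam_ j).
  have [[[[Mm nm im] m1] fm] _] := minlam0_ j.
  split=> //; split=> //; split=> //.
  by apply: negligibleS nm; exact/subsetC/sub.
have [[[_ _ ilam] lam1] _] := Elam.
have lam1_ j : lam_ j setT = 1%E by case: (Elam_ j) => -[].
have ilam_ j : (energy alpha (lam_ j) (lam_ j) < +oo)%E by case: (Elam_ j) => -[[]].
have r0 := rieszk_ge0 (n := n) alpha.
(* Existence of minimizers makes the infima real numbers, so the convergence already proved for [wf]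
   can be read in [R]. *)
pose w_ j := real_energy (rieszk alpha) (lam_ j) (lam_ j) + 2 * fieldint F f (lam_ j).
pose w := real_energy (rieszk alpha) lam lam + 2 * fieldint F f lam.
have cw : w_ @ \oo --> w.
  have wE : wf alpha F f A = w%:E.
    by rewrite -(fenergyE alpha F f A mF lam Elam); case: minlam0.
  have w_E : (fun j => wf alpha F f (A_ j)) = (fun j => (w_ j)%:E).
    apply/funext => j; rewrite -(fenergyE alpha F f A mF (lam_ j) (Elam_ j)).
    by case: (minlam0_ j).
  by move: wcvg; rewrite wE w_E => /fine_cvg.
have dle j : energy_dist2 (rieszk alpha) (lam_ j) lam <= 2 * (w_ j - w).
  exact: (minimizer_dist2_le alpha alphan F f A mF).
have dge j : 0 <= energy_dist2 (rieszk alpha) (lam_ j) lam.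
  by apply: energy_dist2_ge0 => //; [exact: pos_def_rieszk alpha alphan|exact: ilam_].
have dcvg : (fun j => energy_dist2 (rieszk alpha) (lam_ j) lam) @ \oo --> (0 : R).
  have c2 : (fun j => 2 * (w_ j - w)) @ \oo --> (0 : R).
    rewrite -[X in _ --> X](_ : 2 * (w - w) = 0); last by rewrite subrr mulr0.
    exact: cvgM (cvg_cst _) (cvgB cw (cvg_cst _)).
  apply: (squeeze_cvgr _ (cvg_cst 0) c2).
  by apply: nearW => j; rewrite dge dle.
split.
- have /choice[s Hs] := fun j => jordan_signed_radon alpha alphan (lam_ j) lam (ilam_ j) ilam.
  exists s; split; first by move=> j; case: (Hs j).
  have -> : (fun j => snorm (s j)) =
      (fun j => Num.sqrt (energy_dist2 (rieszk alpha) (lam_ j) lam)).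
    by apply/funext => j; case: (Hs j).
  rewrite -[X in _ --> X](sqrtr0 R).
  by apply: cvg_comp dcvg _; exact: sqrt_continuous.
- exact: (energy_cvg_vague alpha alphan lam_ lam).
- rewrite (cfE alpha alphan F f A mF AF lam Elam).
  have -> : (fun j => cf alpha F f (lam_ j)) = (fun j =>
      (real_energy (rieszk alpha) (lam_ j) (lam_ j) + fieldint F f (lam_ j))%:E).
    by apply/funext => j; exact: (cfE alpha alphan F f A mF AF).
  apply: cvg_EFin; first exact: nearW.
  have ce := real_energy_cvg alpha alphan lam_ lam ilam_ ilam dcvg.
  (* Half the sum of the energy and the minimal value, both of which are already known to
     converge. *)
  have cE (m : {finite_measure set (Rn R n) -> \bar R}) :
      real_energy (rieszk alpha) m m + fieldint F f m = 2^-1 *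
      (real_energy (rieszk alpha) m m + (real_energy (rieszk alpha) m m + 2 * fieldint F f m)).
    by field.
  rewrite cE (_ : _ \o _ = (fun j =>
    2^-1 * (real_energy (rieszk alpha) (lam_ j) (lam_ j) + w_ j))).
    exact: cvgM (cvg_cst _) (cvgD ce cw).
  by apply/funext => j; rewrite /= cE.
Qed.
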